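(* Let $n\geqslant 2$ be an integer. There exists a constant $C(n)\geqslant 0$ depending only on $n$ such that for all integers $\delta\geqslant 1$ and $d\geqslant 1$, all pure dimensional closed subschemes $X$ of $\mathbb{P}^n_{\mathbb{Q}}$ of dimension $d$ and degree $\delta$, and all real $B\geqslant 1$, \[\#S(X;B)\leqslant C(n)\,\delta B^{d+1}.\]
   Context: For $\xi\in\mathbb{P}^n(\mathbb{Q})$ write $\xi=[\xi_0:\cdots:\xi_n]$ with $\xi_i\in\mathbb{Z}$ and $\gcd(\xi_0,\ldots,\xi_n)=1$; its height is $H_{\mathbb{Q}}(\xi)=\max_{0\leqslant i\leqslant n}|\xi_i|$. For a closed subscheme $X$ of $\mathbb{P}^n_{\mathbb{Q}}$, $S(X;B)=\{\xi\in X(\mathbb{Q})\mid H_{\mathbb{Q}}(\xi)\leqslant B\}$. A scheme is pure dimensional if all its irreducible components have the same dimension. The degree is taken with respect to $\mathcal{O}(1)$. *)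

(* Defs.v *)
From HB Require Import structures.
From mathcomp Require Import all_boot all_order all_algebra.
From mathcomp Require Import mpoly.
From mathcomp Require Export reals.

Set Implicit Arguments.
Unset Strict Implicit.
Unset Printing Implicit Defensive.

Import Order.TTheory GRing.Theory Num.Theory.
Local Open Scope ring_scope.

(* Closed subschemes of P^n over Q are the Proj(Q[X_0,...,X_n]/I) for I a
   homogeneous ideal.  [idealr_closed] asks for 1 \notin I, which loses no
   subscheme: the empty one is also defined by the ideal (X_0,...,X_n).
   Several ideals may define the same subscheme, but the notions below depend
   on I only through Proj(Q[X_0,...,X_n]/I). *)
Record closed_subscheme (n : nat) := ClosedSubscheme {
  ideal_of :> {pred {mpoly rat[n.+1]}};
  ideal_of_closed : idealr_closed ideal_of;
  ideal_of_homog :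
    forall (f : {mpoly rat[n.+1]}) (k : nat),
      f \in ideal_of -> pihomog mdeg k f \in ideal_of
}.

(* The points of the scheme P^n: homogeneous primes not containing the
   irrelevant ideal (X_0,...,X_n). *)
Record proj_point (n : nat) := ProjPoint {
  point_ideal :> closed_subscheme n;
  point_prime : prime_idealr_closed point_ideal;
  point_relevant : exists i : 'I_n.+1, 'X_i \notin (point_ideal : {pred _})
}.

Definition pset (n : nat) := proj_point n -> Prop.

Definition psubset (n : nat) (Y Z : pset n) : Prop := forall p, Y p -> Z p.

Definition support (n : nat) (X : closed_subscheme n) : pset n :=
  fun p => {subset X <= (p : {pred {mpoly rat[n.+1]}})}.

Definition zariski_closed (n : nat) (Z : pset n) : Prop :=
  exists J : closed_subscheme n, forall p, Z p <-> support J p.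

Definition irreducible_closed (n : nat) (Z : pset n) : Prop :=
  [/\ zariski_closed Z,
      exists p, Z p
    & forall A B : pset n, zariski_closed A -> zariski_closed B ->
        (forall p, Z p -> A p \/ B p) -> psubset Z A \/ psubset Z B].

Definition irreducible_component (n : nat) (X : closed_subscheme n)
    (Z : pset n) : Prop :=
  [/\ irreducible_closed Z,
      psubset Z (support X)
    & forall Z' : pset n, irreducible_closed Z' -> psubset Z' (support X) ->
        psubset Z Z' -> psubset Z' Z].

Definition has_chain (n : nat) (Z : pset n) (k : nat) : Prop :=
  exists c : nat -> pset n,
    (forall i, (i <= k)%N -> irreducible_closed (c i) /\ psubset (c i) Z) /\
    (forall i, (i < k)%N -> psubset (c i) (c i.+1) /\ ~ psubset (c i.+1) (c i)).

Definition krull_dim (n : nat) (Z : pset n) (d : nat) : Prop :=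
  has_chain Z d /\ forall k, has_chain Z k -> (k <= d)%N.

Definition pure_dimensional (n : nat) (X : closed_subscheme n) : Prop :=
  forall Z Z' : pset n,
    irreducible_component X Z -> irreducible_component X Z' ->
    forall e : nat, krull_dim Z e -> krull_dim Z' e.

Definition dimension (n : nat) (X : closed_subscheme n) (d : nat) : Prop :=
  krull_dim (support X) d.

(* h is the dimension over Q of the degree m part of Q[X_0,...,X_n]/I *)
Definition hilbert_function (n : nat) (X : closed_subscheme n) (m h : nat) :
    Prop :=
  exists U : {vspace dhomog n.+1 rat m},
    (forall f : dhomog n.+1 rat m,
       f \in U <-> (f : {mpoly rat[n.+1]}) \in (X : {pred _})) /\
    h = (\dim (fullv : {vspace dhomog n.+1 rat m}) - \dim U)%N.

Definition hilbert_polynomial (n : nat) (X : closed_subscheme n)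
    (P : {poly rat}) : Prop :=
  exists m0 : nat, forall m : nat, (m0 <= m)%N ->
    exists2 h : nat, hilbert_function X m h & P.[m%:R] = h%:R.

(* The degree with respect to O(1): (dim X)! times the leading coefficient of
   the Hilbert polynomial. *)
Definition degree (n : nat) (X : closed_subscheme n) (delta : nat) : Prop :=
  exists (d : nat) (P : {poly rat}),
    [/\ dimension X d, hilbert_polynomial X P
      & lead_coef P * (d`!)%:R = delta%:R].

(* P^n(Q), as the set of lines in Q^(n+1) *)
Definition rat_point (n : nat) :=
  {L : {vspace 'rV[rat]_n.+1} | \dim L == 1%N}.

(* x is one of the two (opposite) vectors of coprime integral homogeneous
   coordinates of xi *)
Definition primitive_coords (n : nat) (xi : rat_point n)
    (x : 'rV[int]_n.+1) : Prop :=
  \big[gcdn/0%N]_(i < n.+1) `|x ord0 i|%N = 1%N /\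
  val xi = <[map_mx intr x : 'rV[rat]_n.+1]>%VS.

Definition height (n : nat) (x : 'rV[int]_n.+1) : nat :=
  (\max_(i < n.+1) `|x ord0 i|)%N.

(* Membership in S(X; B).  As X is homogeneous, the vanishing condition and the
   height are the same for both choices of x. *)
Definition in_S (R : realType) (n : nat) (X : closed_subscheme n) (B : R)
    (xi : rat_point n) : Prop :=
  exists x : 'rV[int]_n.+1,
    [/\ primitive_coords xi x,
        forall f : {mpoly rat[n.+1]}, f \in (X : {pred _}) ->
          f.@[fun i => (x ord0 i)%:~R] = 0
      & (height x)%:R <= B].

(* Main.v *)
(* Let I be the homogeneous ideal of X and D = dim X + 1.  Choose D linear forms l
   over which Q[X_0..X_n]/I is finite, so that T = Q[l] is a polynomial ring, and
   let r be the rank of Q[X_0..X_n]/I over T.  The graded pieces of a free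
   submodule of rank r bound r by a constant times the degree of X.

   Integral vectors of the box [-b, b]^(n+1) are separated by polynomials of degree
   at most m = 2b(n+1).  Let E be the set of those on which I vanishes, and choose
   a point c of Spec T over which the module is free.  If #E exceeds r times the
   number of monomials in D variables with exponents at most m, some nonzero
   combination f of the separating polynomials has all its coordinates over T
   vanishing to order m + 1 at c.  Then the coordinates of f^k vanish to order
   k(m + 1) at c, but their degrees are at most km + const: for large k they are
   zero, so f^k is T-torsion modulo I.  Since X is pure dimensional, no minimal
   prime of I contains a nonzero element of T, hence f vanishes on E, against the
   choice of f.  Therefore #E <= r (m + 1)^D. *)

Require Import Defs.
From HB Require Import structures.
From mathcomp Require Import all_boot all_order all_algebra ring zify.
From mathcomp Require Import mpoly polyrcf.
From mathcomp Require boolp classical_sets.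
Import Order.TTheory GRing.Theory Num.Theory.
Local Open Scope ring_scope.

Set Implicit Arguments.
Unset Strict Implicit.
Unset Printing Implicit Defensive.

(** Why powers: the coordinates of an element of degree m over T have degree bounded only by m + c0,
    where c0, like the denominator g of the generic basis, depends on X. Order m + 1 at c does not
    kill them, and asking for a larger order would bring c0 into the bound. Passing to f^k
    multiplies the order by k but leaves the excess c0 unchanged, so k = c0 + 1 is enough; g and c0
    leave no trace in the count, where only r and D remain.

    Why minimal primes: purity constrains irreducible components only. Embedded components may be
    killed by nonzero elements of T, so f^k need not lie in I. It lies in every minimal prime, and
    each point of E contains one in its ideal.

    Why vectors: points of E are counted on the affine cone, which has D parameters; this yields the
    exponent d + 1, and it is why inhomogeneous separating polynomials and filtered, not graded,
    degree bounds are used.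

    The working notion of dimension is the number of parameters in a normalization; chains of
    irreducible sets are compared with it through hyperplane sections. *)

(** * Linear relations, orders of vanishing, points where a polynomial is nonzero *)

Lemma fin_pigeonhole (K : fieldType) (I J : finType) (c : I -> J -> K) :
  (#|J| < #|I|)%N ->
  exists2 lam : I -> K, exists i, lam i != 0 &
    forall j, \sum_i lam i * c i j = 0.
Proof.
move=> ltJI.
pose C := \matrix_(i < #|I|, j < #|J|) c (enum_val i) (enum_val j).
have : kermx C != 0.
  rewrite -mxrank_eq0 mxrank_ker subn_eq0 -ltnNge.
  by apply: leq_ltn_trans ltJI; apply: rank_leq_col.
case/rowV0Pn => v /sub_kermxP vC v0.
exists (fun i => v ord0 (enum_rank i)).
  have [j vj] : exists j, v ord0 j != 0.
    apply/existsP; apply: contraNT v0; rewrite negb_exists => /forallP h.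
    by apply/eqP/rowP => j; rewrite mxE; apply/eqP; move: (h j); rewrite negbK.
  by exists (enum_val j); rewrite enum_valK.
move=> j; have := congr1 (fun w : 'rV_(#|J|) => w ord0 (enum_rank j)) vC.
rewrite !mxE; apply: etrans.
rewrite (reindex (@enum_val I I)) /=; last exact/onW_bij/enum_val_bij.
by apply: eq_bigr => i _; rewrite !mxE enum_valK enum_rankK.
Qed.

Section OrderOfVanishing.
Variables (K : idomainType) (n : nat).
Implicit Types p q : {mpoly K[n]}.

Definition ord_ge e p := forall m : 'X_{1..n}, (mdeg m < e)%N -> p@_m = 0.

Lemma ord_ge0 e : ord_ge e 0.
Proof. by move=> m _; rewrite mcoeff0. Qed.

Lemma ord_geD e p q : ord_ge e p -> ord_ge e q -> ord_ge e (p + q).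
Proof. by move=> hp hq m hm; rewrite mcoeffD hp ?hq ?addr0. Qed.

Lemma ord_ge_sum e (I : Type) (r : seq I) (P : pred I) (F : I -> {mpoly K[n]}) :
  (forall i, P i -> ord_ge e (F i)) -> ord_ge e (\sum_(i <- r | P i) F i).
Proof.
by move=> h; elim/big_ind: _ => //; [apply: ord_ge0 | apply: ord_geD].
Qed.

Lemma ord_geM a b p q : ord_ge a p -> ord_ge b q -> ord_ge (a + b) (p * q).
Proof.
move=> hp hq m hm; rewrite mcoeffM big1 // => -[i j] /= /eqP e.
have h : (mdeg i + mdeg j < a + b)%N by rewrite -mdegD -e.
have [ltia|leai] := ltnP (mdeg i) a; first by rewrite hp ?mul0r.
rewrite [q@_ _]hq ?mulr0 //; rewrite -(ltn_add2l (mdeg i)).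
by apply: leq_trans h _; rewrite leq_add2r.
Qed.

Lemma ord_ge_le a b p : (a <= b)%N -> ord_ge b p -> ord_ge a p.
Proof. by move=> leab h m hm; apply: h; apply: leq_trans leab. Qed.

(** Write p q_0 = p q - p (q - q_0), where q_0 is the constant term. As q - q_0 has order at least
    1, the order of p can be raised by one at a time until it reaches e. *)
Lemma ord_ge_divr e p q : q@_0%MM != 0 -> ord_ge e (p * q) -> ord_ge e p.
Proof.
move=> q0 hpq.
suff h j : (j <= e)%N -> ord_ge j p by exact: h.
elim: j => [_ m|j IH ltje]; first by rewrite ltn0.
have hq' : ord_ge 1 (q - (q@_0)%:MP).
  move=> m; rewrite ltnS leqn0 mdeg_eq0 => /eqP ->.
  by rewrite mcoeffB mcoeffC eqxx mulr1 subrr.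
have hs : ord_ge j.+1 (p * (q@_0)%:MP).
  rewrite -[X in p * X](subKr q) mulrBr -mulrN.
  apply: ord_geD; first exact: ord_ge_le hpq.
  rewrite -addn1; apply: ord_geM; first exact/IH/ltnW.
  by move=> m hm; rewrite mcoeffN hq' ?oppr0.
move=> m hm; have /eqP := hs m hm.
by rewrite mulrC mcoeffCM mulf_eq0 (negbTE q0) => /eqP.
Qed.

Lemma ord_ge_eq0 e p : (msize p <= e)%N -> ord_ge e p -> p = 0.
Proof.
move=> sp hp; apply/mpolyP => m; rewrite mcoeff0.
have [/hp //|lem] := ltnP (mdeg m) e.
by apply/memN_msupp_eq0/msize_mdeg_ge/(leq_trans sp).
Qed.
End OrderOfVanishing.

Lemma digits_inj (n s : nat) (a b : 'I_n -> nat) :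
  (forall i, a i < s)%N -> (forall i, b i < s)%N ->
  (\sum_(i < n) a i * s ^ i = \sum_(i < n) b i * s ^ i)%N -> a =1 b.
Proof.
elim: n a b => [|n IH] a b la lb; first by move=> _ [].
rewrite !big_ord_recl !expn0 !muln1.
have E (c : 'I_n.+1 -> nat) : (\sum_(i < n) c (lift ord0 i) * s ^ lift ord0 i =
    (\sum_(i < n) c (lift ord0 i) * s ^ i) * s)%N.
  by rewrite big_distrl; apply: eq_bigr => i _ /=; rewrite expnSr mulnA.
rewrite !E => e.
have e0 : a ord0 = b ord0.
  by have := congr1 (modn^~ s) e;
    rewrite ![(_ + _ * s)%N]addnC !modnMDl !modn_small.
have s0 : (0 < s)%N by apply: leq_ltn_trans (la ord0).
move: e; rewrite e0 => /addnI/eqP; rewrite eqn_pmul2r // => /eqP /IH h i.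
by case: (unliftP ord0 i) => [j ->|-> //]; apply: h.
Qed.

Lemma poly_nonroot (K : numFieldType) (p : {poly K}) :
  p != 0 -> exists t, p.[t] != 0.
Proof.
move=> p0; pose s := [seq (i%:R : K) | i <- iota 0 (size p)].
have us : uniq s by rewrite map_inj_uniq ?iota_uniq // => i j /eqP;
  rewrite eqr_nat => /eqP.
have /allPn[t _ ht] : ~~ all (root p) s.
  by apply/negP => h; have := max_poly_roots p0 h us;
    rewrite size_map size_iota ltnn.
by exists t.
Qed.

(* Kronecker substitution: c_i = t^(s^i), with s above all exponents of p. *)
Lemma mpoly_nonroot (K : numFieldType) (n : nat) (p : {mpoly K[n]}) :
  p != 0 -> exists c : 'I_n -> K, p.@[c] != 0.
Proof.
move=> p0; pose s := msize p.
pose kron (m : 'X_{1..n}) := (\sum_(i < n) m i * s ^ i)%N.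
pose P : {poly K} := \sum_(m <- msupp p) p@_m *: 'X^(kron m).
have digit m : m \in msupp p -> forall i, (m i < s)%N.
  move=> /msize_mdeg_lt h i; apply: leq_ltn_trans h.
  by rewrite mdegE (bigD1 i) //= leq_addr.
have /poly_nonroot[t Pt] : P != 0.
  apply/negP => /eqP /(congr1 (fun q : {poly K} => q`_(kron (mlead p)))).
  rewrite coef0 coef_sum (bigD1_seq (mlead p)) ?msupp_uniq ?mlead_supp //=.
  rewrite coefZ coefXn eqxx mulr1 big1_seq ?addr0.
    by move/eqP; rewrite mleadc_eq0 (negbTE p0).
  move=> m /andP[ne ms]; rewrite coefZ coefXn eq_sym; case: eqP => [e|];
    last by rewrite mulr0.
  case/eqP: ne; apply/mnmP; apply: digits_inj e; apply: digit => //.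
  exact: mlead_supp.
exists (fun i => t ^+ (s ^ i)); rewrite mevalE; move: Pt; rewrite /P horner_sum.
congr (_ != _); apply: eq_bigr => m _; rewrite hornerZ hornerXn; congr (_ * _).
by rewrite -prodrXr; apply: eq_bigr => i _; rewrite -exprM mulnC.
Qed.

(** * Powers of an element vanishing at a fat point *)

Section FatPoint.
Variables (K : fieldType) (D : nat) (A : comNzRingType).
Variables (tau : {rmorphism {mpoly K[D]} -> A}) (J : finType) (u : J -> A).
Implicit Types (p a b : J -> {mpoly K[D]}) (x y : A).

Definition lin_comb p := \sum_j tau (p j) * u j.
Definition lin_indep := forall p, lin_comb p = 0 -> forall j, p j = 0.

Lemma lin_combD a b : lin_comb (fun j => a j + b j) = lin_comb a + lin_comb b.
Proof. by rewrite /lin_comb -big_split; apply: eq_bigr => j _;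
  rewrite rmorphD mulrDl. Qed.

Lemma lin_comb_sum (I : finType) (a : I -> J -> {mpoly K[D]}) :
  lin_comb (fun j => \sum_i a i j) = \sum_i lin_comb (a i).
Proof.
rewrite /lin_comb exchange_big; apply: eq_bigr => j _.
by rewrite rmorph_sum mulr_suml.
Qed.

Lemma lin_combZ c a : lin_comb (fun j => c * a j) = tau c * lin_comb a.
Proof. by rewrite /lin_comb mulr_sumr; apply: eq_bigr => j _;
  rewrite rmorphM mulrA. Qed.

Lemma lin_indep_inj : lin_indep ->
  forall a b, lin_comb a = lin_comb b -> a =1 b.
Proof.
move=> ind a b e j; apply/eqP; rewrite -subr_eq0; apply/eqP.
apply: (ind (fun j => a j - b j)); apply/eqP.
rewrite (lin_combD a (fun j => - b j)) e -[X in _ + X]opprK.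
rewrite subr_eq0 /lin_comb -sumrN; apply/eqP; apply: eq_bigr => i _.
by rewrite rmorphN mulNr opprK.
Qed.

Hypothesis u_indep : lin_indep.
Variable g : {mpoly K[D]}.
Hypothesis u_mul : forall i j, exists c, tau g * (u i * u j) = lin_comb c.

Lemma lin_comb_mul : exists c : J -> J -> J -> {mpoly K[D]}, forall a b,
  tau g * (lin_comb a * lin_comb b) =
  lin_comb (fun l => \sum_i \sum_j a i * b j * c i j l).
Proof.
have [c hc] : exists c : J -> J -> J -> {mpoly K[D]},
    forall i j, tau g * (u i * u j) = lin_comb (c i j).
  apply: (@fin_all_exists J (fun=> J -> J -> {mpoly K[D]}) (fun i c => forall j,
    tau g * (u i * u j) = lin_comb (c j))) => i.
  exact: (@fin_all_exists J (fun=> J -> {mpoly K[D]}) (fun j c =>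
    tau g * (u i * u j) = lin_comb c)).
exists c => a b; rewrite lin_comb_sum.
rewrite {1}/lin_comb mulr_suml mulr_sumr; apply: eq_bigr => i _.
rewrite lin_comb_sum /lin_comb !mulr_sumr; apply: eq_bigr => j _.
rewrite -/(lin_comb _) lin_combZ -hc rmorphM; ring.
Qed.

(** Orders add up under multiplication. The powers of g that accumulate are harmless, since g will
    be nonzero at the origin and can be divided out by [ord_ge_divr]. *)
Lemma power_ord_ge m (f : A) a :
    tau g * f = lin_comb a -> (forall j, ord_ge m (a j)) ->
  forall k, exists e, exists2 b, tau g ^+ e * f ^+ k.+1 = lin_comb b &
    forall j, ord_ge (k.+1 * m) (b j).
Proof.
move=> fa am; have [c hc] := lin_comb_mul.
elim=> [|k [e [b fb bm]]].
  by exists 1%N, a; rewrite ?expr1 ?mul1n.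
(* One new factor g clears the products [u i * u j], the other one comes with [tau g * f]. *)
exists (e.+2), (fun l => \sum_i \sum_j b i * a j * c i j l).
  by rewrite -hc -fb -fa !exprS; move: (tau g) (tau g ^+ e) (f ^+ k) => G Ge fk;
    ring.
move=> l; rewrite mulSn addnC; apply: ord_ge_sum => i _; apply: ord_ge_sum => j _.
by rewrite -[(_ + _)%N]addn0; apply: ord_geM => //; apply: ord_geM.
Qed.

(** The linear conditions are the vanishing of the coefficients of each coordinate at all exponents
    of the cube [0, m]^D. There are #J (m + 1)^D of them, and the cube contains every exponent of
    degree at most m, so they force order m + 1. *)
Lemma fat_point_kernel_origin (I : finType) (f : I -> A) (m c0 : nat) :
    g@_0%MM != 0 ->
    (forall i, exists a, tau g * f i = lin_comb a) ->
    (forall (lam : I -> K) k, exists2 p,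
      tau g * (\sum_i tau (lam i)%:MP * f i) ^+ k = lin_comb p &
      forall j, (msize (p j) <= k * m + c0)%N) ->
    (#|J| * m.+1 ^ D < #|I|)%N ->
  exists2 lam : I -> K, exists i, lam i != 0 &
    exists k, tau g * (\sum_i tau (lam i)%:MP * f i) ^+ k = 0.
Proof.
move=> g0 /(@fin_all_exists I (fun=> J -> {mpoly K[D]}))[a ha] hf ltJI.
pose X := {ffun 'I_D -> 'I_m.+1}.
pose mnm (al : X) := [multinom (al i : nat) | i < D].
have [|lam lam0 hlam] := @fin_pigeonhole K I (J * X)%type
  (fun i jal => (a i jal.1)@_(mnm jal.2)).
  by rewrite card_prod card_ffun !card_ord.
exists lam => //; set F := \sum_i _.
pose b j := \sum_i (lam i)%:MP * a i j.
have Fb : tau g * F = lin_comb b.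
  rewrite /b lin_comb_sum mulr_sumr; apply: eq_bigr => i _.
  by rewrite lin_combZ -ha mulrCA.
have bm j : ord_ge m.+1 (b j).
  move=> al hal; have hi i : (al i < m.+1)%N.
    by apply: leq_ltn_trans hal; rewrite mdegE (bigD1 i) //= leq_addr.
  have := hlam (j, [ffun i => Ordinal (hi i)]).
  have -> : mnm [ffun i => Ordinal (hi i)] = al.
    by apply/mnmP => i; rewrite mnmE ffunE.
  by move=> <-; rewrite raddf_sum /=; apply: eq_bigr => i _; rewrite mcoeffCM.
(* For k = c0 + 1 the size bound k m + c0 no longer exceeds the order k (m + 1). *)
exists c0.+1; have [p Fp sp] := hf lam c0.+1.
have [e [q Fq qm]] := power_ord_ge Fb bm c0.
(* The size bound is known for the coordinates p of g F^k, the order for the coordinates q of g^e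
   F^k. Independence gives g^e p = g q, which transfers the order to p. *)
have pq : lin_comb (fun j => g ^+ e * p j) = lin_comb (fun j => g * q j).
  by rewrite !lin_combZ -Fp -Fq rmorphXn mulrCA.
rewrite -/F Fp /lin_comb big1 // => j _;
  rewrite (@ord_ge_eq0 _ _ (c0.+1 * m.+1) (p j)).
- by rewrite rmorph0 mul0r.
- by apply: leq_trans (sp j) _; rewrite mulnS addnC leq_add2r.
apply: (@ord_ge_divr _ _ _ _ (g ^+ e)).
  by rewrite rmorphXn expf_neq0.
rewrite mulrC (lin_indep_inj u_indep pq); rewrite -[(_ * _)%N]add0n.
by apply: ord_geM.
Qed.

End FatPoint.

(** * Degrees under substitution, and translation of the variables *)

Lemma mpoly_rmorph_ext (K : nzRingType) (n : nat) (A : comNzRingType)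
    (phi psi : {rmorphism {mpoly K[n]} -> A}) :
  (forall c, phi c%:MP = psi c%:MP) -> (forall i, phi 'X_i = psi 'X_i) ->
    phi =1 psi.
Proof.
move=> hC hX p; rewrite [p]mpolyE !rmorph_sum; apply: eq_bigr => m _.
rewrite -mul_mpolyC !rmorphM hC; congr (_ * _).
rewrite mpolyXE_id !rmorph_prod; apply: eq_bigr => i _.
by rewrite !rmorphXn hX.
Qed.

Section DegreeBounds.
Variables (K : idomainType) (n : nat).
Implicit Types p q : {mpoly K[n]}.

Lemma msizeM_leD p q a b :
  (msize p <= a.+1 -> msize q <= b.+1 -> msize (p * q) <= (a + b).+1)%N.
Proof.
have [->|p0] := eqVneq p 0; first by rewrite mul0r msize0.
have [->|q0] := eqVneq q 0; first by rewrite mulr0 msize0.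
move=> ha hb; rewrite msizeM //.
by have := leq_add ha hb; rewrite addSn addnS; case: (_ + _)%N.
Qed.

Lemma msizeX_le p a k : (msize p <= a.+1 -> msize (p ^+ k) <= (k * a).+1)%N.
Proof.
move=> pa; elim: k => [|k IH]; first by rewrite expr0 msize1.
by rewrite exprS mulSn; apply: msizeM_leD.
Qed.

Lemma msize_sum_le (I : Type) (r : seq I) (P : pred I) (F : I -> {mpoly K[n]}) a :
  (forall i, P i -> msize (F i) <= a)%N -> (msize (\sum_(i <- r | P i) F i) <= a)%N.
Proof.
move=> h; elim/big_ind: _ => [|p q hp hq|//]; first by rewrite msize0.
by apply: leq_trans (msizeD_le _ _) _; rewrite geq_max hp hq.
Qed.

Lemma msize_mmap1_le m (h : 'I_m -> {mpoly K[n]}) a (al : 'X_{1..m}) :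
  (forall i, msize (h i) <= a.+1)%N -> (msize (mmap1 h al) <= (mdeg al * a).+1)%N.
Proof.
move=> ha; rewrite /mmap1 mdegE big_distrl /=.
elim/big_rec2: _ => [|i p q _ IH]; first by rewrite msize1.
by apply: msizeM_leD => //; apply: msizeX_le.
Qed.

Lemma msize_mmap_le m (h : 'I_m -> {mpoly K[n]}) (p : {mpoly K[m]}) a e :
  (forall i, msize (h i) <= a.+1)%N -> (msize p <= e.+1)%N ->
  (msize (mmap (@mpolyC n K) h p) <= (e * a).+1)%N.
Proof.
move=> ha pe; rewrite /mmap big_seq; apply: msize_sum_le => al alp.
rewrite mul_mpolyC; apply: leq_trans (msizeZ_le _ _) _.
apply: leq_trans (msize_mmap1_le _ ha) _; rewrite ltnS leq_mul2r -ltnS.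
by rewrite (leq_trans (msize_mdeg_lt alp)) ?orbT.
Qed.

End DegreeBounds.

Section Translation.
Variables (K : idomainType) (n : nat).

Definition mtrans (c : 'I_n -> K) : {mpoly K[n]} -> {mpoly K[n]} :=
  mmap (@mpolyC n K) (fun i => 'X_i + (c i)%:MP).

HB.instance Definition _ c := GRing.RMorphism.on (mtrans c).

Lemma mtransK c : cancel (mtrans c) (mtrans (fun i => - c i)).
Proof.
apply: (@mpoly_rmorph_ext _ _ _ (mtrans (fun i => - c i) \o mtrans c) idfun).
  by move=> a /=; rewrite /mtrans !mmapC.
move=> i /=; rewrite {2}/mtrans mmapX mmap1U rmorphD /= /mtrans mmapC mmapX mmap1U.
by rewrite -addrA -mpolyCD addNr addr0.
Qed.

Lemma mtrans_mcoeff0 c p : (mtrans c p)@_0%MM = p.@[c].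
Proof.
apply: (@mpoly_rmorph_ext _ _ _ (mcoeff 0%MM \o mtrans c) (meval c)).
  by move=> a /=; rewrite /mtrans mmapC mpolyCK mevalC.
move=> i /=; rewrite /mtrans mmapX mmap1U mevalXU mcoeffD mpolyCK mcoeffX.
by rewrite mnm1_eq0 add0r.
Qed.

Lemma msize_mtrans_le c p : (msize (mtrans c p) <= msize p)%N.
Proof.
have [->|p0] := eqVneq p 0; first by rewrite rmorph0.
have : (0 < msize p)%N by rewrite lt0n msize_poly_eq0.
case sp: (msize p) => [//|e] _; rewrite -[e]muln1.
apply: msize_mmap_le; last by rewrite sp.
move=> i; apply: leq_trans (msizeD_le _ _) _.
by rewrite msizeX mdeg1 msizeC geq_max; case: (_ != _).
Qed.

End Translation.

(** A point c with g(c) nonzero is moved to the origin. The translation is an automorphism of the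
    polynomial ring that does not raise degrees, so independence and size bounds survive. *)
Lemma fat_point_kernel (K : numFieldType) (D : nat) (A : comNzRingType)
    (tau : {rmorphism {mpoly K[D]} -> A}) (J I : finType) (u : J -> A)
    (g : {mpoly K[D]}) (f : I -> A) (m c0 : nat) :
  lin_indep tau u -> g != 0 ->
  (forall i j, exists c, tau g * (u i * u j) = lin_comb tau u c) ->
  (forall i, exists a, tau g * f i = lin_comb tau u a) ->
  (forall (lam : I -> K) k, exists2 p,
      tau g * (\sum_i tau (lam i)%:MP * f i) ^+ k = lin_comb tau u p &
      forall j, (msize (p j) <= k * m + c0)%N) ->
  (#|J| * m.+1 ^ D < #|I|)%N ->
  exists2 lam : I -> K, exists i, lam i != 0 &
    exists k, tau g * (\sum_i tau (lam i)%:MP * f i) ^+ k = 0.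
Proof.
move=> ind /mpoly_nonroot[c gc] hu hf hfk lt.
pose tr := mtrans c; pose tau' : {rmorphism _ -> _} := tau \o mtrans (fun i =>
  - c i).
have tauE p : tau p = tau' (tr p) by rewrite /tau' /= mtransK.
have trC a : tau' a%:MP = tau a%:MP by rewrite tauE /tr /mtrans mmapC.
have lcE p : lin_comb tau u p = lin_comb tau' u (fun j => tr (p j)).
  by apply: eq_bigr => j _; rewrite tauE.
have [||||||lam lam0 [k hk]] :=
  @fat_point_kernel_origin _ _ _ tau' _ u _ (tr g) _ _ f m c0.
- move=> p hp j; have := ind (fun j => mtrans (fun i => - c i) (p j)) hp j.
  move=> /(congr1 (mtrans (fun i => - - c i))); rewrite rmorph0.
  by rewrite mtransK.
- move=> i j; have [a ha] := hu i j; exists (fun j => tr (a j)).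
  by rewrite -tauE -lcE.
- by rewrite mtrans_mcoeff0.
- by move=> i; have [a ha] := hf i; exists (fun j => tr (a j)); rewrite -tauE -lcE.
- move=> lam k; have [p hp sp] := hfk lam k; exists (fun j => tr (p j)).
    rewrite -tauE -lcE -hp; congr (_ * _ ^+ _).
    by apply: eq_bigr => i _; rewrite trC.
  by move=> j; apply: leq_trans (msize_mtrans_le _ _) _.
- by [].
exists lam => //; exists k; rewrite -[RHS]hk -tauE; congr (_ * _ ^+ _).
by apply: eq_bigr => i _; rewrite trC.
Qed.

(** * Noether normalization by linear forms *)

Section HomogeneousParts.
Variables (K : idomainType) (n : nat).
Implicit Types p q : {mpoly K[n]}.
Local Notation ph := (pihomog (@mdeg n)).

Lemma pihomog_sum k (I : Type) (s : seq I) (P : pred I) (F : I -> {mpoly K[n]}) :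
  ph k (\sum_(i <- s | P i) F i) = \sum_(i <- s | P i) ph k (F i).
Proof. exact: linear_sum. Qed.

Lemma pihomog_mull d p k q : p \is d.-homog -> ph (d + k) (p * q) = p * ph k q.
Proof.
move=> hp; rewrite [q in LHS](@pihomog_partitionE _ _ (@mdeg n) (maxn (msize q)
  k.+1)); last first.
  by rewrite leq_maxl.
rewrite mulr_sumr pihomog_sum (bigD1 (Ordinal (leq_maxr (msize q) k.+1))) //=.
rewrite pihomog_dE; last by rewrite dhomogM // pihomogP.
rewrite big1 ?addr0 // => i ne; apply: (@pihomog_ne0 _ _ _ (d + i)).
  by rewrite eqn_add2l; apply: contraNneq ne => e; apply/eqP/val_inj.
by rewrite dhomogM // pihomogP.
Qed.

Lemma pihomog_mull0 d p k q : p \is d.-homog -> (k < d)%N -> ph k (p * q) = 0.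
Proof.
move=> hp lt; rewrite [q](@pihomog_partitionE _ _ (@mdeg n) (msize q)) //.
rewrite mulr_sumr pihomog_sum big1 // => i _.
apply: (@pihomog_ne0 _ _ _ (d + i)); last by rewrite dhomogM // pihomogP.
by rewrite gtn_eqF // ltn_addr.
Qed.

Lemma pihomog_msize k p : (msize (ph k p) <= k.+1)%N.
Proof.
rewrite msizeE; apply/bigmax_leqP_seq => m mp _; rewrite ltnS.
by have /dhomogP/(_ _ mp) /= -> := pihomogP (@mdeg n) k p.
Qed.

Lemma dhomog_msize_le d p : p \is d.-homog -> (msize p <= d.+1)%N.
Proof. by move=> h; rewrite -(pihomog_dE h) pihomog_msize. Qed.

End HomogeneousParts.

Section Evaluation.
Variables (n r : nat) (l : 'I_r -> {mpoly rat[n]}).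

Definition ev : {mpoly rat[r]} -> {mpoly rat[n]} := mmap (@mpolyC n rat) l.
HB.instance Definition _ := GRing.RMorphism.on ev.

Lemma evC c : ev c%:MP = c%:MP. Proof. exact: mmapC. Qed.
Lemma evX i : ev 'X_i = l i. Proof. by rewrite /ev mmapX mmap1U. Qed.
Lemma evZ c p : ev (c *: p) = c *: ev p.
Proof. by rewrite /ev mmapZ mul_mpolyC. Qed.

Lemma mmap1_homog d (m : 'X_{1..r}) : (forall i, l i \is d.-homog) ->
  mmap1 l m \is (d * mdeg m).-homog.
Proof.
move=> hl; rewrite /mmap1 mdegE big_distrr /=.
elim/big_rec2: _ => [|i p q _ IH]; first exact: dhomog1.
by apply: dhomogM => //; apply: dhomogMn.
Qed.

Lemma ev_homog d e p : (forall i, l i \is d.-homog) -> p \is e.-homog ->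
  ev p \is (d * e).-homog.
Proof.
move=> hl /dhomogP hp; rewrite /ev /mmap big_seq; apply: rpred_sum => m mp.
by rewrite mul_mpolyC rpredZ // -(hp _ mp) mmap1_homog.
Qed.

Lemma pihomog_ev e p : (forall i, l i \is 1.-homog) ->
  pihomog (@mdeg n) e (ev p) = ev (pihomog (@mdeg r) e p).
Proof.
move=> hl; rewrite [p in LHS](@pihomog_partitionE _ _ (@mdeg r) (maxn (msize p)
  e.+1)); last first.
  by rewrite leq_maxl.
rewrite (rmorph_sum ev) !pihomog_sum (bigD1 (Ordinal (leq_maxr (msize p) e.+1)))
  //=.
have hd k : ev (pihomog (@mdeg r) k p) \is k.-homog.
  by rewrite -[k in k.-homog]mul1n; apply: ev_homog => //; apply: pihomogP.
rewrite pihomog_dE // big1 ?addr0 // => i ne.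
by apply: (@pihomog_ne0 _ _ _ i).
Qed.

End Evaluation.

HB.instance Definition _ n (X : closed_subscheme n) :=
  isIdealr.Build _ (ideal_of X) (ideal_of_closed X).

Section Ideals.
Variable n : nat.
Implicit Types X Y : closed_subscheme n.
Local Notation R := {mpoly rat[n.+1]}.

Lemma ideal1 X : (1 : R) \in (X : {pred _}) = false.
Proof. exact: idealr1. Qed.

Lemma idealMl X (a f : R) : f \in (X : {pred _}) -> a * f \in (X : {pred _}).
Proof. exact: idealMr. Qed.

Lemma idealC X c : (c%:MP : R) \in (X : {pred _}) -> c = 0.
Proof.
move=> cX; apply/eqP/negPn/negP => c0; have := ideal1 X.
by rewrite (_ : 1 = (c^-1)%:MP * c%:MP) ?idealMl // -mpolyCM mulVf.
Qed.

Lemma ideal_homog X k (f : R) : f \in (X : {pred _}) ->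
  pihomog (@mdeg n.+1) k f \in (X : {pred _}).
Proof. exact: ideal_of_homog. Qed.

Lemma quotient_morphism X : exists (A : comNzRingType) (pi : {rmorphism R -> A}),
  forall f, (f \in (X : {pred _})) = (pi f == 0).
Proof.
exists {ideal_quot (ideal_of X)},
  (\pi_({ideal_quot (ideal_of X)})%qT : {rmorphism _ -> _}) => f.
by rewrite -[f in LHS]subr0 Quotient.idealrBE raddf0.
Qed.

(** The ideal I + (l), which cuts X by the linear space l = 0. It is proper because the multiples of
    the l_i have no part of degree 0, so 1 would already lie in I. *)
Lemma plus_subscheme X r (l : 'I_r -> R) : (forall i, l i \is 1.-homog) ->
  exists Y : closed_subscheme n, forall f : R,
    f \in (Y : {pred _}) <-> exists h : 'I_r -> R,
      f - \sum_i l i * h i \in (X : {pred _}).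
Proof.
move=> hl.
pose S (f : R) := exists h : 'I_r -> R, f - \sum_i l i * h i \in (X : {pred _}).
pose P : {pred R} := fun f => boolp.asbool (S f).
have PE f : (f \in P) = boolp.asbool (S f) by [].
have closed : idealr_closed P.
  split.
  - rewrite PE; apply/boolp.asboolP; exists (fun=> 0).
    by rewrite big1 ?subr0 ?rpred0 // => i _; rewrite mulr0.
  - rewrite PE; apply/boolp.asboolPn => -[h /(ideal_homog 0)].
    rewrite pihomogB pihomog_sum [X in _ - X]big1 => [|i _];
      last by rewrite (pihomog_mull0 _ (hl i)).
    by rewrite subr0 pihomog_dE ?dhomog1 // ideal1.
  - move=> a f g; rewrite !PE => /boolp.asboolP[h hf] /boolp.asboolP[h' hg].
    apply/boolp.asboolP; exists (fun i => a * h i + h' i).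
    rewrite (_ : _ - _ = a * (f - \sum_i l i * h i) + (g - \sum_i l i * h' i)).
      by rewrite rpredD // idealMl.
    rewrite mulrBr mulr_sumr addrACA -opprD -big_split; congr (_ - _).
    by apply: eq_bigr => i _ /=; ring.
have Phomog f k : f \in P -> pihomog (@mdeg _) k f \in P.
  rewrite !PE => /boolp.asboolP[h hf]; apply/boolp.asboolP.
  exists (fun i => if k is k'.+1 then pihomog (@mdeg _) k' (h i) else 0).
  apply: etrans (ideal_homog k hf); rewrite pihomogB pihomog_sum.
  congr (in_mem (_ - _) _); apply: eq_bigr => i _; case: k => [|k].
    by rewrite (pihomog_mull0 _ (hl i)) // mulr0.
  by rewrite -(add1n k) (pihomog_mull _ _ (hl i)).
by exists (ClosedSubscheme closed Phomog) => f; rewrite PE; split=> /boolp.asboolP.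
Qed.

(* The linear forms l cut X in the empty set, that is, Q[X_0..X_n]/I is finite
   over its subring generated by l. *)
Definition finite_over X r (l : 'I_r -> R) := exists N, forall m : 'X_{1..n.+1},
  mdeg m = N -> exists h : 'I_r -> R, 'X_[m] - \sum_i l i * h i \in (X : {pred _}).

Definition alg_indep X r (q : 'I_r -> R) :=
  forall p, ev q p \in (X : {pred _}) -> p = 0.

Definition parameters X r := exists2 l : 'I_r -> R,
  forall i, l i \is 1.-homog & finite_over X l.

Lemma mnm_split (a b : nat) (m : 'X_{1..n.+1}) : mdeg m = (a + b)%N ->
  exists m1 m2, [/\ m = (m1 + m2)%MM, mdeg m1 = a & mdeg m2 = b].
Proof.
elim: a b => [|a IH] b; first by exists 0%MM, m; rewrite add0m mdeg0.
rewrite addSnnS => /IH[m1 [m2 [-> d1 d2]]].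
have [i hi] : exists i, (0 < m2 i)%N.
  have [i hi|h] := pickP (fun i => 0 < m2 i)%N; first by exists i.
  suff : mdeg m2 = 0%N by rewrite d2.
  by rewrite mdegE big1 // => i _; apply/eqP; rewrite -leqn0 leqNgt h.
have le : (U_(i) <= m2)%MM by rewrite lep1mP -lt0n.
exists (m1 + U_(i))%MM, (m2 - U_(i))%MM; split.
- by rewrite -addmA; congr (_ + _)%MM; rewrite addmC submK.
- by rewrite mdegD mdeg1 d1 addn1.
- by have := congr1 (@mdeg _) (submK le); rewrite mdegD mdeg1 d2 addn1 => -[].
Qed.

(** Homogeneous coefficients are obtained by taking the part of degree N + 1. One variable is
    multiplied in first, so that the degree of the coefficients is N and no truncated N - 1
    occurs. *)
Lemma finite_over_gt0 X r (l : 'I_r -> R) : (forall i, l i \is 1.-homog) ->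
  finite_over X l -> exists N, forall m : 'X_{1..n.+1},
  mdeg m = N.+1 -> exists2 h : 'I_r -> R, forall i, h i \is N.-homog &
    'X_[m] - \sum_i l i * h i \in (X : {pred _}).
Proof.
move=> hl [N hN]; exists N => m dm.
have [m1 [m2 [-> d1 d2]]] := @mnm_split N 1 m (etrans dm (esym (addn1 N))).
have [h hh] := hN m1 d1; exists (fun i => pihomog (@mdeg _) N (h i * 'X_[m2])).
  by move=> i; apply: pihomogP.
apply: etrans (ideal_homog N.+1 (idealMl 'X_[m2] hh)).
rewrite mulrBr pihomogB -mpolyXD [(m2 + m1)%MM]addmC pihomog_dE; last first.
  by rewrite dhomogX /= mdegD d1 d2 addn1.
congr (in_mem (_ - _) _); rewrite mulr_sumr pihomog_sum; apply: eq_bigr => i _.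
by rewrite -(add1n N) mulrCA (pihomog_mull _ _ (hl i)) [h i * _]mulrC.
Qed.

(** Graded Nakayama: a monomial of large degree is, modulo I, a combination of the l_i with
    coefficients of smaller degree, and induction on the degree applies. The clause on [e < mdeg b]
    excludes the constants that the truncated [e - mdeg b] would allow. *)
Lemma graded_reduction X r (l : 'I_r -> R) : (forall i, l i \is 1.-homog) ->
    finite_over X l ->
  exists N, forall e (f : R), f \is e.-homog ->
  exists p : 'X_{1..n.+1 < N} -> {mpoly rat[r]},
    (forall b, p b \is (e - mdeg b).-homog /\ ((e < mdeg b)%N -> p b = 0)) /\
    f - lin_comb (ev l) (fun b : 'X_{1..n.+1 < N} => 'X_[b]) p \in (X : {pred _}).
Proof.
move=> hl /(finite_over_gt0 hl)[N hN]; exists N.+1 => e.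
have [d] := ubnP e; elim: d e => // d IH e led f hf.
set u := fun b : 'X_{1..n.+1 < N.+1} => _.
pose Q f := exists p : 'X_{1..n.+1 < N.+1} -> {mpoly rat[r]},
    (forall b, p b \is (e - mdeg b).-homog /\ ((e < mdeg b)%N -> p b = 0)) /\
    f - lin_comb (ev l) u p \in (X : {pred _}).
have Q0 : Q 0.
  exists (fun=> 0); split; first by move=> b; rewrite dhomog0.
  by rewrite /lin_comb big1 ?subr0 ?rpred0 // => b _; rewrite rmorph0 mul0r.
have QD f1 f2 : Q f1 -> Q f2 -> Q (f1 + f2).
  move=> [p1 [d1 h1]] [p2 [d2 h2]]; exists (fun b => p1 b + p2 b); split.
    move=> b; have [a1 b1] := d1 b; have [a2 b2] := d2 b.
    by split=> [|lt]; [rewrite dhomogD | rewrite b1 // b2 // addr0].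
  by rewrite lin_combD opprD addrACA rpredD.
have QZ c f1 : Q f1 -> Q (c *: f1).
  move=> [p1 [d1 h1]]; exists (fun b => c%:MP * p1 b); split.
    move=> b; have [a1 b1] := d1 b; rewrite mul_mpolyC.
    by split=> [|lt]; [rewrite rpredZ | rewrite b1 // scaler0].
  by rewrite lin_combZ /= evC -mul_mpolyC -mulrBr idealMl.
suff QX m : mdeg m = e -> Q 'X_[m].
  rewrite -/(Q f) [f]mpolyE big_seq; elim/big_ind: _ => // m mf.
  by apply/QZ/QX; move/dhomogP: hf; apply.
move=> dm; have [ltN|leN] := ltnP (mdeg m) N.+1.
  exists (fun b => if b == BMultinom ltN then 1 else 0); split.
    move=> b; case: eqP => [->|_] /=; last by rewrite dhomog0.
    by rewrite -dm subnn ltnn dhomog1.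
  rewrite /lin_comb (bigD1 (BMultinom ltN)) //= eqxx rmorph1 mul1r.
  rewrite big1 ?addr0 ?subrr ?rpred0 // => b /negbTE ->.
  by rewrite rmorph0 mul0r.
have [m1 [m2 [e12 d1 d2]]] := @mnm_split N.+1 (mdeg m - N.+1) m (esym (subnKC leN)).
have [h hh hX] := hN m1 d1.
case: e led dm hf {Q0 QD QZ} @Q => [|e] led dm hf Q; first by rewrite dm in leN.
have hs i : h i * 'X_[m2] \is e.-homog.
  have -> : e = (N + mdeg m2)%N.
    by apply: succn_inj; rewrite -dm e12 mdegD d1.
  by rewrite dhomogM // dhomogX.
have /(@fin_all_exists _ (fun=> _ -> _))[p hp] i := IH e led _ (hs i).
exists (fun b => \sum_i 'X_i * p i b); split.
  move=> b; split.
    apply: rpred_sum => i _; have [hb0 hb] := (hp i).1 b.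
    have [leb|/hb ->] := leqP (mdeg b) e; last by rewrite mulr0 dhomog0.
    by rewrite subSn // -[(_ - _).+1]add1n dhomogM // dhomogX /= mdeg1.
  by move=> lt; rewrite big1 // => i _; rewrite (((hp i).1 b).2 (ltnW lt)) mulr0.
rewrite lin_comb_sum.
rewrite (_ : _ - _ = 'X_[m2] * ('X_[m1] - \sum_i l i * h i) +
   \sum_i l i * (h i * 'X_[m2] - lin_comb (ev l) u (p i))).
  rewrite rpredD ?idealMl // rpred_sum // => i _.
  by rewrite idealMl //; exact: (hp i).2.
rewrite mulrBr -mpolyXD [(m2 + m1)%MM]addmC -e12 -addrA; congr (_ + _).
rewrite mulr_sumr -!sumrN -big_split; apply: eq_bigr => i _.
by rewrite lin_combZ /= evX /=; ring.
Qed.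
End Ideals.

Definition mnm_of_ffun (r m : nat) (al : {ffun 'I_r -> 'I_m.+1}) : 'X_{1..r} :=
  [multinom (al i : nat) | i < r].

Lemma mnm_of_ffun_inj r m : injective (@mnm_of_ffun r m).
Proof.
move=> a b e; apply/ffunP => i; apply: val_inj.
by have := congr1 (fun x : 'X_{1..r} => x i) e; rewrite !mnmE.
Qed.

Lemma mdeg_mnm_of_ffun r m (al : {ffun 'I_r ->
  'I_m.+1}) : (mdeg (mnm_of_ffun al) <= r * m)%N.
Proof.
rewrite mdegE -[r in (r * m)%N]card_ord -sum_nat_const; apply: leq_sum => i _.
by rewrite mnmE -ltnS.
Qed.

Lemma mnm_of_ffun_surj r m (al : 'X_{1..r}) : (mdeg al <= m)%N ->
  exists be : {ffun 'I_r -> 'I_m.+1}, al = mnm_of_ffun be.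
Proof.
move=> le; exists [ffun i => inord (al i)].
apply/mnmP => i; rewrite mnmE ffunE inordK // ltnS.
by apply: leq_trans le; rewrite mdegE (bigD1 i) //= leq_addr.
Qed.

(** * Counting parameters: growth, algebraic relations, existence of a normalization *)

Section Dimension.
Variable n : nat.
Implicit Types X Y : closed_subscheme n.
Local Notation R := {mpoly rat[n.+1]}.

Lemma filtered_reduction X r (l : 'I_r -> R) : (forall i, l i \is 1.-homog) ->
    finite_over X l ->
  exists N, forall e (f : R), (msize f <= e.+1)%N ->
  exists p : 'X_{1..n.+1 < N} -> {mpoly rat[r]},
    (forall b, (msize (p b) <= e.+1)%N) /\
    f - lin_comb (ev l) (fun b : 'X_{1..n.+1 < N} => 'X_[b]) p \in (X : {pred _}).
Proof.
move=> hl /(graded_reduction hl)[N hN]; exists N => e f hf.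
have /(@fin_all_exists _ (fun=> _ -> _))[p hp] (d : 'I_e.+1) :=
  hN d _ (pihomogP (@mdeg _) d f).
exists (fun b => \sum_d p d b); split.
  move=> b; apply: msize_sum_le => d _; have [h _] := (hp d).1 b.
  apply: leq_trans (dhomog_msize_le h) _; rewrite ltnS.
  by apply: leq_trans (leq_subr _ _) _; rewrite -ltnS.
rewrite lin_comb_sum [f in f - _](pihomog_partitionE hf) -sumrB.
by apply: rpred_sum => d _; exact: (hp d).2.
Qed.

(** The quotient in degrees at most e has dimension O((e + 1)^r'): C counts the monomials of degree
    less than N, and each has a coefficient whose exponents in the r' parameters lie in [0, e]. *)
Lemma finite_pigeonhole X r' : parameters X r' ->
  exists C, forall e (J : finType) (v : J -> R), (forall j,
    msize (v j) <= e.+1)%N ->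
  (C * e.+1 ^ r' < #|J|)%N ->
  exists2 lam : J -> rat, exists j,
    lam j != 0 & \sum_j lam j *: v j \in (X : {pred _}).
Proof.
move=> [l hl /(filtered_reduction hl)[N hN]]; exists #|{: 'X_{1..n.+1 < N}}| =>
  e J v hv lt.
have /(@fin_all_exists _ (fun=> _ -> _))[p hp] j := hN e (v j) (hv j).
have [|lam lam0 hlam] := @fin_pigeonhole rat J ('X_{1..n.+1 < N} * {ffun 'I_r' ->
  'I_e.+1})%type
  (fun j bal => (p j bal.1)@_(mnm_of_ffun bal.2)).
  by rewrite card_prod card_ffun !card_ord.
exists lam => //.
rewrite (_ : \sum_j _ = \sum_j (lam j)%:MP *
  (v j - lin_comb (ev l) (fun b : 'X_{1..n.+1 < N} => 'X_[b]) (p j))).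
  by apply: rpred_sum => j _; apply: idealMl; exact: (hp j).2.
apply/eqP; rewrite -subr_eq0 -sumrB; apply/eqP.
rewrite (eq_bigr (fun j => lin_comb (ev l) (fun b : 'X_{1..n.+1 < N} => 'X_[b])
   (fun b => (lam j)%:MP * p j b))); last first.
  by move=> j _; rewrite lin_combZ /= evC -mul_mpolyC; ring.
rewrite -lin_comb_sum /lin_comb big1 // => b _.
rewrite (_ : \sum_j _ = 0) ?rmorph0 ?mul0r //.
apply/mpolyP => al; rewrite mcoeff0 raddf_sum /=.
have [lte|/(mnm_of_ffun_surj (m := e))[be ->]] := ltnP e (mdeg al); last first.
  by apply: etrans (hlam (b, be)); apply: eq_bigr => j _; rewrite mcoeffCM.
rewrite big1 // => j _; rewrite mcoeffCM memN_msupp_eq0 ?mulr0 //.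
by apply: msize_mdeg_ge; apply: leq_trans ((hp j).1 b) _.
Qed.

(** There are (m + 1)^r (s + 1) products q^al f^i with exponents bounded by m and s, and their
    degrees are O(m + s). Keeping m and s apart serves both uses: s = 0 compares r with r', while m
    = s makes f algebraic over the q_i. *)
Lemma alg_relation X r' r (q : 'I_r -> R) (f : R) : parameters X r' ->
  exists C, forall m s, (C * (m + s).+1 ^ r' < m.+1 ^ r * s.+1)%N ->
  exists2 p : 'I_s.+1 -> {mpoly rat[r]}, exists i, p i != 0 &
    \sum_i ev q (p i) * f ^+ i \in (X : {pred _}).
Proof.
move=> /finite_pigeonhole[C hC].
pose a := maxn (msize f) (\max_i msize (q i)).
have qa i : (msize (q i) <= a.+1)%N.
  by apply: leqW; rewrite leq_max (leq_bigmax (F := fun i => msize (q i))) orbT.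
have fa : (msize f <= a.+1)%N by rewrite leqW // leq_maxl.
exists (C * (r * a + a).+1 ^ r')%N => m s lt.
pose J := ({ffun 'I_r -> 'I_m.+1} * 'I_s.+1)%type.
pose v (j : J) : R := mmap1 q (mnm_of_ffun j.1) * f ^+ j.2.
have [||lam [[al i] lam0] hlam] := hC (r * m * a + s * a)%N _ v.
- move=> [al i]; apply: msizeM_leD.
    apply: leq_trans (msize_mmap1_le _ qa) _.
    by rewrite ltnS leq_mul2r mdeg_mnm_of_ffun orbT.
  by apply: leq_trans (msizeX_le _ fa) _; rewrite ltnS leq_mul2r -ltnS ltn_ord orbT.
- rewrite card_prod card_ffun !card_ord; apply: leq_ltn_trans lt.
  rewrite -[leqRHS]mulnA -expnMn leq_mul2l; apply/orP; right.
  by case: (r') => // k; rewrite leq_exp2r //; nia.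
exists (fun i => \sum_al lam (al, i) *: 'X_[mnm_of_ffun al]).
  exists i; apply/eqP => /(congr1 (mcoeff (mnm_of_ffun al))).
  rewrite mcoeff0 raddf_sum /= (bigD1 al) //= mcoeffZ mcoeffX eqxx mulr1.
  rewrite big1 ?addr0; first by move/eqP; rewrite (negbTE lam0).
  move=> be ne; rewrite mcoeffZ mcoeffX; case: eqP => [/mnm_of_ffun_inj e|];
    last by rewrite mulr0.
  by rewrite e eqxx in ne.
have E : \sum_j lam j *: v j = \sum_al \sum_i lam (al, i) *: v (al, i).
  by rewrite pair_bigA; apply: eq_bigr => -[].
apply: etrans hlam; rewrite E exchange_big /=; congr (in_mem _ _);
  apply: eq_bigr => j _.
rewrite rmorph_sum mulr_suml; apply: eq_bigr => be _.
by rewrite /v /= evZ /ev mmapX -scalerAl.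
Qed.

(** Here r counts parameters of the affine cone, one more than the projective dimension; hence the
    [.+1] in later statements. *)
Definition normalization X r (l : 'I_r -> R) :=
  [/\ forall i, l i \is 1.-homog, finite_over X l & alg_indep X l].

Lemma alg_indep_le X r r' (q : 'I_r -> R) :
  alg_indep X q -> parameters X r' -> (r <= r')%N.
Proof.
move=> ind par; rewrite leqNgt; apply/negP => lt.
have [C hC] := alg_relation q 0 par.
(* With m = C the condition holds because C (C + 1)^r' < (C + 1)^(r' + 1), and r' + 1 <= r. *)
have [|p [i pi]] := hC C 0%N.
  rewrite muln1 addn0; apply: leq_trans (leq_pexp2l _ lt) => //.
  by rewrite expnS ltn_mul2r expn_gt0 /= ltnSn.
rewrite big_ord1 expr0 mulr1 => /ind p0.
by rewrite ord1 p0 eqxx in pi.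
Qed.

Lemma alg_dependence X r (q : 'I_r -> R) (f : R) : parameters X r ->
  exists s, exists2 p : 'I_s.+1 -> {mpoly rat[r]}, exists i, p i != 0 &
    \sum_i ev q (p i) * f ^+ i \in (X : {pred _}).
Proof.
move=> /(alg_relation q f)[C hC].
(* This value gives C (2 (m + 1))^r = m (m + 1)^r, which is less than (m + 1)^r (m + 1). *)
pose m := (C * 2 ^ r)%N; exists m; apply: (hC m).
apply: (@leq_ltn_trans (C * (2 * m.+1) ^ r)).
  rewrite leq_mul2l; apply/orP; right; case: (r) => // k; rewrite leq_exp2r //; lia.
by rewrite expnMn mulnA -/m mulnC ltn_mul2l expn_gt0 /= ltnSn.
Qed.

Lemma ev_collinear (A : comNzRingType) (phi : {rmorphism R -> A}) r (l : 'I_r -> R)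
    (t : 'I_r -> rat) (z : A) e (p : {mpoly rat[r]}) :
  (forall i, phi (l i) = phi (t i)%:MP * z) -> p \is e.-homog ->
  phi (ev l p) = phi (p.@[t])%:MP * z ^+ e.
Proof.
move=> hl /dhomogP hp; rewrite /ev /mmap mevalE !rmorph_sum mulr_suml.
rewrite [LHS]big_seq [RHS]big_seq; apply: eq_bigr => m mp /=.
rewrite -(hp m mp) /= !rmorphM -mulrA; congr (_ * _).
rewrite /mmap1 !rmorph_prod mdegE -prodrXr -big_split; apply: eq_bigr => i _ /=.
by rewrite !rmorphXn hl exprMn.
Qed.

Lemma meval_scale r (a : rat) (t : 'I_r -> rat) e (p : {mpoly rat[r]}) :
  p \is e.-homog -> p.@[fun i => a * t i] = a ^+ e * p.@[t].
Proof.
move=> /dhomogP hp; rewrite !mevalE mulr_sumr.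
rewrite [LHS]big_seq [RHS]big_seq; apply: eq_bigr => m mp /=.
rewrite -(hp m mp) /= mulrCA; congr (_ * _).
rewrite mdegE -prodrXr -big_split; apply: eq_bigr => i _ /=.
by rewrite exprMn.
Qed.

(* If g(l) is in I with g homogeneous of degree e and g(c) <> 0, c_i0 <> 0, then
   modulo the forms l_i - (c_i / c_i0) l_i0 every l_i is proportional to l_i0,
   whence l_i0^e = 0. *)
Lemma parameters_drop X r (l : 'I_r.+1 -> R) : (forall i, l i \is 1.-homog) ->
  finite_over X l -> ~ alg_indep X l -> parameters X r.
Proof.
move=> hl [N hN] nind.
have [g gX g0] : exists2 g, ev l g \in (X : {pred _}) & g != 0.
  apply: boolp.contrapT => h; apply: nind => p pX; apply/eqP/negPn/negP => p0.
  by apply: h; exists p.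
have [e ge0] : exists e, pihomog (@mdeg _) e g != 0.
  apply: boolp.contrapT => h; case/eqP: g0.
  rewrite (pihomog_partitionE (leqnn (msize g))) big1 // => e _.
  by apply/eqP/negPn/negP => ge; apply: h; exists (e : nat).
have {}gX : ev l (pihomog (@mdeg _) e g) \in (X : {pred _}).
  by rewrite -pihomog_ev // ideal_homog.
move: (pihomogP (@mdeg _) e g) ge0 gX; move: (pihomog _ _ _) =>
  {g0}g gh /[dup] g0 /mpoly_nonroot[c gc] gX.
have [i0 ci0] : exists i0, c i0 != 0.
  apply: boolp.contrapT => h; have c0 i : c i = 0.
    by apply/eqP/negPn/negP => ci; apply: h; exists i.
  have E : g.@[c] = 0 ^+ e * g.@[c].
    rewrite -(meval_scale _ _ gh); apply: meval_eq => i.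
    by rewrite c0 mul0r.
  case: e gh E => [gh _|e _]; last by rewrite exprS !mul0r => E;
    rewrite E eqxx in gc.
  have gC : g = (g@_0%MM)%:MP.
    by apply: msize1_polyC; apply: dhomog_msize_le gh.
  by move: gX; rewrite gC evC => /idealC gz; rewrite gC gz mpolyC0 eqxx in g0.
pose t i := c i / c i0.
pose l' (j : 'I_r) : R := l (lift i0 j) - t (lift i0 j) *: l i0.
have hl' j : l' j \is 1.-homog by rewrite /l' rpredB // rpredZ.
exists l' => //.
have [Y hY] := plus_subscheme X hl'.
have [A [pi piY]] := quotient_morphism Y.
have XY (f : R) : f \in (X : {pred _}) -> pi f = 0.
  move=> fX; apply/eqP; rewrite -piY; apply/hY; exists (fun=> 0).
  by rewrite big1 ?subr0 // => i _; rewrite mulr0.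
have pil i : pi (l i) = pi (t i)%:MP * pi (l i0).
  case: (unliftP i0 i) => [j ->|->]; last by rewrite /t divff // rmorph1 mul1r.
  apply/eqP; rewrite -rmorphM -subr_eq0 -rmorphB -piY; apply/hY.
  exists (fun k => (k == j)%:R); rewrite (bigD1 j) //= eqxx mulr1 big1.
    by rewrite addr0 /l' mul_mpolyC subrr rpred0.
  by move=> k /negbTE ->; rewrite mulr0.
have zA : pi (l i0) ^+ e = 0.
  have := XY _ gX; rewrite (ev_collinear pil gh) => h.
  have gt : g.@[t] != 0.
    rewrite (_ : g.@[t] = (c i0)^-1 ^+ e * g.@[c]).
      by rewrite mulf_neq0 // expf_neq0 // invr_neq0.
    by rewrite -(meval_scale _ _ gh); apply: meval_eq => i; rewrite mulrC.
  have := congr1 (fun x => pi ((g.@[t])^-1)%:MP * x) h.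
  by rewrite mulr0 mulrA -rmorphM -mpolyCM mulVf // rmorph1 mul1r.
(* Every block of N variables yields one factor [l i0] modulo Y. Degree N e thus yields its e-th
   power, which is zero, and all monomials of that degree lie in Y. *)
have piX k (m : 'X_{1..n.+1}) : mdeg m = (N * k)%N ->
    exists a, pi 'X_[m] = pi (l i0) ^+ k * a.
  elim: k m => [|k IH] m; first by exists (pi 'X_[m]); rewrite mul1r.
  rewrite mulnS => /mnm_split[m1 [m2 [-> /hN[h /XY hm1] /IH[a hm2]]]].
  exists ((\sum_i pi (t i)%:MP * pi (h i)) * a).
  rewrite mpolyXD rmorphM hm2; move: hm1; rewrite rmorphB => /eqP;
    rewrite subr_eq0 => /eqP ->.
  rewrite rmorph_sum exprS.
  rewrite (eq_bigr (fun i => pi (l i0) * (pi (t i)%:MP * pi (h i)))) => [|i _].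
    by rewrite -mulr_sumr; move: (\sum_i _) (pi _) => x y; rewrite mulrACA mulrA.
  by rewrite (rmorphM pi) pil; move: (pi (t i)%:MP) (pi _) (pi (h i)) => x y w;
    rewrite mulrAC mulrC.
exists (N * e)%N => m /piX[a]; rewrite zA mul0r => /eqP; rewrite -piY => /hY.
by [].
Qed.

Lemma parameters_vars X : parameters X n.+1.
Proof.
exists (fun i => 'X_i); first by move=> i; rewrite dhomogX /= mdeg1.
exists 1%N => m /eqP; rewrite mdeg_eq1 => /existsP[i /eqP ->].
exists (fun j => (j == i)%:R); rewrite (bigD1 i) //= eqxx mulr1 big1.
  by rewrite addr0 subrr rpred0.
by move=> j /negbTE ->; rewrite mulr0.
Qed.

(** A finite system with the fewest forms is independent: a relation would let [parameters_drop]
    remove one. With no forms left a relation is a constant, and I contains no nonzero constant. *)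
Lemma normalization_exists X : exists r (l : 'I_r -> R), normalization X l.
Proof.
have ex : exists r, boolp.asbool (parameters X r).
  by exists n.+1; apply/boolp.asboolP/parameters_vars.
have := ex_minnP ex; case=> r /boolp.asboolP[l hl fin] rmin.
exists r, l; split=> //; apply: boolp.contrapT.
case: r l hl fin rmin => [|r] l hl fin rmin nind.
  apply: nind => p; have -> : p = (p@_0%MM)%:MP by rewrite mpolyKC.
  by rewrite evC => /idealC ->.
by have := rmin r (boolp.asboolT (parameters_drop hl fin nind)); rewrite ltnn.
Qed.

Lemma normalization_par X r (l : 'I_r -> R) : normalization X l -> parameters X r.
Proof. by case=> hl fin _; exists l. Qed.

Lemma finite_overS X Y r (l : 'I_r -> R) : {subset X <= (Y : {pred R})} ->
  finite_over X l -> finite_over Y l.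
Proof. by move=> XY [N hN]; exists N => m /hN[h /XY hh]; exists h. Qed.

Lemma parametersS X Y r : {subset X <= (Y : {pred R})} -> parameters X r ->
  parameters Y r.
Proof. by move=> XY [l hl fin]; exists l => //; apply: finite_overS fin. Qed.

Lemma alg_indepS X Y r (q : 'I_r -> R) : {subset X <= (Y : {pred R})} ->
  alg_indep Y q -> alg_indep X q.
Proof. by move=> XY ind p /XY /ind. Qed.

Lemma alg_indep_of_dim X r (l l' : 'I_r -> R) : (forall i, l i \is 1.-homog) ->
  finite_over X l -> normalization X l' -> alg_indep X l.
Proof.
move=> hl fin [_ _ ind']; apply: boolp.contrapT.
case: r l l' hl fin ind' => [|r] l l' hl fin ind' nind.
  apply: nind => p; have -> : p = (p@_0%MM)%:MP by rewrite mpolyKC.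
  by rewrite evC => /idealC ->.
by have := alg_indep_le ind' (parameters_drop hl fin nind); rewrite ltnn.
Qed.

End Dimension.

(** * Homogeneous primes and Krull dimension *)

(** Krull's argument: an ideal maximal among those containing I and missing the multiplicative set S
    is prime. *)
Lemma prime_avoiding (R : comNzRingType) (I : {pred R}) (S : R -> Prop) :
    idealr_closed I -> S 1 -> (forall s t, S s -> S t -> S (s * t)) ->
    (forall s, S s -> s \notin I) ->
  exists P : {pred R}, [/\ idealr_closed P, prime_idealr_closed P,
    {subset I <= P} & forall s, S s -> s \notin P].
Proof.
move=> [I0 I1 IM] S1 SM SI.
pose isI (A : R -> Prop) := [/\ forall x, x \in I -> A x,
  forall x y, A x -> A y -> A (x + y), forall a x, A x -> A (a * x) &
  forall s, S s -> ~ A s].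
have II : isI (fun x => x \in I).
  split=> // [x y xI yI|a x xI|s /SI/negP //].
    by rewrite -[x]mul1r IM.
  by rewrite -[_ * _]addr0 IM.
pose good (A : R -> Prop) := (forall x, ~ A x) \/ isI A.
have [|A [gA maxA]] := @classical_sets.Zorn_bigcup R good.
  move=> F Fgood Ftot.
  have [[A0 [FA0 iA0]]|no] := boolp.EM (exists A, F A /\ isI A); last first.
    left=> x [A FA Ax]; case: (Fgood A FA) => [nA|iA]; first exact: (nA x).
    by apply: no; exists A.
  have iF A x : F A -> A x -> isI A by move=> /Fgood [nA /nA|].
  right; split.
  - by move=> x xI; exists A0 => //; case: iA0 => h _ _ _; apply: h.
  - move=> x y [A FA Ax] [B FB By].
    have [AB|BA] := Ftot A B FA FB.
      by exists B => //; have [_ h _ _] := iF B y FB By; apply: h => //; apply: AB.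
    by exists A => //; have [_ h _ _] := iF A x FA Ax; apply: h => //; apply: BA.
  - by move=> a x [A FA Ax]; exists A => //; have [_ _ h _] := iF A x FA Ax;
    apply: h.
  - by move=> s Ss [A FA As]; have [_ _ _ h] := iF A s FA As; apply: (h s).
have sub (B : R -> Prop) x : isI B -> (forall y, A y -> B y) -> B x -> A x.
  move=> iB AB Bx; apply: boolp.contrapT => Ax.
  apply: (maxA B); last by right.
  by split=> // BA; apply/Ax/BA.
have iA : isI A.
  case: gA => // nA; case: (nA 0); apply: (sub _ 0 II) => // y /nA //.
have [IA AD AM AS] := iA.
exists (fun x => boolp.asbool (A x)); split.
- split.
  + by apply/boolp.asboolP/IA.
  + by apply/boolp.asboolP/AS.
  + by move=> a x y /boolp.asboolP Ax /boolp.asboolP Ay;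
    apply/boolp.asboolP/AD/Ay/AM.
- move=> u v /boolp.asboolP Auv; apply/negPn/negP; rewrite negb_or =>
  /andP[/negP nu /negP nv].
  (* By maximality the ideal A + (w) meets S. Two such elements, for u and v, have their product in
     A when uv is in A. *)
  have hit w : ~ A w -> exists s a c, [/\ S s, A a & s = a + c * w].
    move=> nw; apply: boolp.contrapT => nex; apply: nw.
    apply: (sub (fun x => exists a c, A a /\ x = a + c * w)).
    - split.
      + by move=> x /IA Ax; exists x, 0; rewrite mul0r addr0.
      + move=> x y [a [c [Aa ->]]] [b [d [Ab ->]]]; exists (a + b), (c + d).
        by split; [apply: AD | ring].
      + move=> e x [a [c [Aa ->]]]; exists (e * a), (e * c).
        by split; [apply: AM | ring].
      + by move=> s Ss [a [c [Aa e]]]; apply: nex; exists s, a, c.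
    - by move=> y Ay; exists y, 0; rewrite mul0r addr0.
    - by exists 0, 1; rewrite add0r mul1r; split=> //; apply: IA.
  have [|s [a [c [Ss Aa es]]]] := hit u; first by move=> Au; apply: nu;
    apply/boolp.asboolP.
  have [|t [b [d [St Ab et]]]] := hit v; first by move=> Av; apply: nv;
    apply/boolp.asboolP.
  case: (AS (s * t)); first exact: SM.
  have -> : s * t = t * a + ((c * u) * b + (c * d) * (u * v)) by rewrite es et;
    ring.
  apply/AD; first exact/AM.
  by apply/AD; apply/AM.
- by move=> x /IA Ax; apply/boolp.asboolP.
- by move=> s /AS nA; apply/boolp.asboolP.
Qed.

Lemma pihomogM (K : idomainType) n k (p q : {mpoly K[n]}) :
  pihomog (@mdeg n) k (p * q) =
  \sum_(i < k.+1) pihomog (@mdeg n) i p * pihomog (@mdeg n) (k - i) q.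
Proof.
pose N := maxn (msize p) k.+1.
rewrite [p in LHS](@pihomog_partitionE _ _ (@mdeg n) N) ?leq_maxl //.
rewrite mulr_suml pihomog_sum.
rewrite (big_ord_widen N (fun i =>
  pihomog (@mdeg n) i p * pihomog (@mdeg n) (k - i) q)) ?leq_maxr //.
rewrite [RHS]big_mkcond; apply: eq_bigr => i _; case: ltnP => [le|lt].
  by rewrite -{1}(subnKC (le : i <= k)%N) (pihomog_mull _ _ (pihomogP (@mdeg n) i
    p)).
by rewrite (pihomog_mull0 _ (pihomogP (@mdeg n) i p)).
Qed.

Section Primes.
Variable n : nat.
Implicit Types X Y : closed_subscheme n.
Local Notation R := {mpoly rat[n.+1]}.

(** The largest homogeneous ideal inside P. It is prime: if a and b are the lowest degrees where the
    parts of u and v leave P, then every other term of degree a + b in uv has a factor in P. *)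
Lemma homog_core (P : {pred R}) : idealr_closed P -> prime_idealr_closed P ->
  exists Q : closed_subscheme n, prime_idealr_closed (Q : {pred R}) /\
    forall f : R, f \in (Q : {pred R}) <-> forall k, pihomog (@mdeg _) k f \in P.
Proof.
move=> [P0 P1 Plin] Pprime.
have PM a u : u \in P -> a * u \in P by move=> uP; rewrite -[_ * _]addr0 Plin.
have PD u v : u \in P -> v \in P -> u + v \in P by move=> uP; rewrite -[u]mul1r;
  apply: Plin.
have Psum m (F : 'I_m -> R) (Q : pred 'I_m) : (forall i, Q i -> F i \in P) ->
  \sum_(i | Q i) F i \in P.
  by move=> h; elim/big_ind: _.
pose C : {pred R} := fun f => boolp.asbool (forall k, pihomog (@mdeg _) k f \in P).
have CP f : reflect (forall k,
  pihomog (@mdeg _) k f \in P) (f \in C) by apply: boolp.asboolP.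
have Cclosed : idealr_closed C.
  split.
  - by apply/CP => k; rewrite pihomog0.
  - by apply/CP => /(_ 0); rewrite pihomog_dE ?dhomog1 //; apply/negP.
  - move=> a u v /CP uC /CP vC; apply/CP => k; rewrite pihomogD pihomogM.
    by apply: PD => //; apply: Psum => i _; apply: PM.
have Chomog f k : f \in C -> pihomog (@mdeg _) k f \in C.
  move=> /CP fC; apply/CP => j.
  have [->|ne] := eqVneq k j; first by rewrite pihomog_id.
  by rewrite (pihomog_ne0 ne) ?pihomogP.
exists (ClosedSubscheme Cclosed Chomog); split; last by move=> f; split=> /CP.
have low f : f \notin C -> exists2 a, pihomog (@mdeg _) a f \notin P &
    forall b, (b < a)%N -> pihomog (@mdeg _) b f \in P.
  move=> /CP nC; have ex : exists a, pihomog (@mdeg _) a f \notin P.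
    by apply: boolp.contrapT => h; apply: nC => k; apply/negPn/negP => hk;
      apply: h; exists k.
  have [a ha mina] := ex_minnP ex; exists a => // b lt; apply/negPn/negP => /mina.
  by rewrite leqNgt lt.
move=> u v /CP uv; apply/negPn/negP; rewrite negb_or =>
  /andP[/low[a ua la] /low[b vb lb]].
have := uv (a + b)%N; rewrite pihomogM => h.
have lt : (a < (a + b).+1)%N by rewrite ltnS leq_addr.
have : pihomog (@mdeg _) a u * pihomog (@mdeg _) b v \in P.
  move: h; rewrite (bigD1 (Ordinal lt)) //= addKn; set s := \sum_(_ | _) _ => h.
  have sP : s \in P.
    apply: Psum => i ne; have [lti|lei] := ltnP i a;
      first by rewrite mulrC PM // la.
    rewrite PM // lb // ltn_subLR; last by rewrite -ltnS ltn_ord.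
    rewrite ltn_add2r ltn_neqAle lei andbT; apply: contraNneq ne => e.
    by apply/eqP/val_inj.
  rewrite -[X in X \in P](addrK s) PD // -mulN1r; exact: PM.
by move/Pprime; rewrite (negbTE ua) (negbTE vb).
Qed.

(** Independence says that the nonzero polynomials in l form a multiplicative set missing I. A prime
    avoiding them keeps l independent, and so does its homogeneous core, degree by degree. *)
Lemma prime_over_indep X r (l : 'I_r -> R) : (forall i, l i \is 1.-homog) ->
  alg_indep X l -> exists Q : closed_subscheme n,
  [/\ prime_idealr_closed (Q : {pred R}),
    {subset X <= (Q : {pred R})} & alg_indep Q l].
Proof.
move=> hl ind.
have [||||P [Pc Pp XP SP]] := @prime_avoiding R X (fun s => exists2 p,
  p != 0 & s = ev l p).
- exact: ideal_of_closed.
- by exists 1; rewrite ?oner_neq0 ?rmorph1.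
- by move=> s t [p p0 ->] [q q0 ->]; exists (p * q); rewrite ?mulf_neq0 // rmorphM.
- by move=> s [p p0 ->]; apply: contraNN p0 => /ind ->.
have [Q [Qp hQ]] := homog_core Pc Pp; exists Q; split=> //.
  by move=> f fX; apply/hQ => k; apply/XP/ideal_homog.
move=> p /hQ h; rewrite (pihomog_partitionE (leqnn (msize p))) big1 // => i _.
apply/eqP/negPn/negP => pi0.
have : ev l (pihomog (@mdeg _) i p) \notin P.
  by apply: SP; exists (pihomog (@mdeg _) i p).
by rewrite -pihomog_ev // h.
Qed.

Definition homog_prime X := prime_idealr_closed (X : {pred R}).

Lemma homog_primeX X (f : R) k : homog_prime X -> f ^+ k \in (X : {pred R}) ->
  f \in (X : {pred R}).
Proof.
move=> pX; elim: k => [|k IH]; first by rewrite expr0 ideal1.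
by rewrite exprS => /pX/orP[|/IH].
Qed.

(* An algebraic relation for f in Y over Q[l] modulo X, whose constant term can be
   made nonzero as f is not in X, puts that term in Y. *)
Lemma prime_dim_lt X Y r (l : 'I_r -> R) r' (l' : 'I_r' -> R) (f : R) :
  homog_prime X -> {subset X <= (Y : {pred R})} ->
  f \in (Y : {pred R}) -> f \notin (X : {pred R}) ->
  normalization X l -> normalization Y l' -> (r' < r)%N.
Proof.
move=> pX XY fY fX nX nY; rewrite ltn_neqAle; have [_ _ ind'] := nY.
rewrite (alg_indep_le ind' (parametersS XY (normalization_par nX))) andbT.
apply/negP => /eqP e; subst r'.
have [hl fin ind] := nX.
have indY : alg_indep Y l := alg_indep_of_dim hl (finite_overS XY fin) nY.
have [s [p [i pi] hp]] := alg_dependence l f (normalization_par nX).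
case/eqP: pi; move: (s.+1) p i hp => {}s.
elim: s => [p []//|s IH] p i; rewrite big_ord_recl expr0 mulr1.
rewrite (eq_bigr (fun i => f * (ev l (p (lift ord0 i)) * f ^+ i))); last first.
  by move=> j _; rewrite /= exprS mulrCA.
rewrite -mulr_sumr => h.
have p0 : p ord0 = 0.
  apply: indY; have :=
    rpredB (XY _ h) (idealMl (\sum_(i < s) ev l (p (lift ord0 i)) * f ^+ i) fY).
  by rewrite mulrC addrK.
case: (unliftP ord0 i) => [j ->|-> //]; apply: (IH (fun j => p (lift ord0 j))).
move: h; rewrite p0 rmorph0 add0r => /pX.
by rewrite (negbTE fX).
Qed.

Lemma dhomog1_vars X (f : R) : f \is 1.-homog ->
  (forall i, 'X_i \in (X : {pred R})) -> f \in (X : {pred R}).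
Proof.
move=> /dhomogP hf hX; rewrite [f]mpolyE big_seq; apply: rpred_sum => m mf.
have /eqP := hf m mf; rewrite mdeg_eq1 => /existsP[i /eqP ->].
by rewrite -mul_mpolyC idealMl.
Qed.

Lemma relevant_of_dim X r (l : 'I_r.+1 -> R) : normalization X l ->
  exists i : 'I_n.+1, 'X_i \notin (X : {pred R}).
Proof.
case=> hl _ ind; apply: boolp.contrapT => h.
have lX : ev l 'X_ord0 \in (X : {pred R}).
  rewrite evX; apply: dhomog1_vars => // i; apply/negPn/negP => hi.
  by apply: h; exists i.
have /(congr1 (mcoeff U_(ord0))) := ind _ lX.
by rewrite mcoeff0 mcoeffX eqxx => /eqP; rewrite oner_eq0.
Qed.

Lemma dim_of_relevant X r (l : 'I_r -> R) i : homog_prime X -> normalization X l ->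
  'X_i \notin (X : {pred R}) -> (0 < r)%N.
Proof.
move=> pX [_ fin _] iX; rewrite lt0n; apply/negP => /eqP r0; subst r;
  case: fin => N hN.
have [|h] := hN (U_(i) *+ N)%MM; first by rewrite mdegMn mdeg1 mul1n.
rewrite big_ord0 subr0 -mpolyXn => /(homog_primeX pX).
by rewrite (negbTE iX).
Qed.

Lemma support_sub (P Q : proj_point n) : psubset (Defs.support P) (Defs.support
  Q) <->
  {subset Q <= (P : {pred R})}.
Proof.
by split=> [h|h p Pp f /h /Pp]; first exact (h P (fun _ => id)).
Qed.

Lemma support_irreducible (P : proj_point n) : irreducible_closed (Defs.support P).
Proof.
split; [by exists P | by exists P |].
move=> A B [a ha] [b hb] /(_ P (fun _ => id)) [/ha h|/hb h]; [left|right].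
  by move=> p Pp; apply/ha => f /h /Pp.
by move=> p Pp; apply/hb => f /h /Pp.
Qed.

(* The vanishing ideal of a set of points.  The condition on the constant
   coefficient only matters for the empty set, whose ideal is (X_0,...,X_n). *)
Lemma vanishing_subscheme (Z : pset n) : exists J : closed_subscheme n,
  forall f : R, f \in (J : {pred R}) <->
    f@_0%MM = 0 /\ forall p : proj_point n, Z p -> f \in (p : {pred R}).
Proof.
pose S (f : R) := f@_0%MM = 0 /\ forall p : proj_point n, Z p ->
  f \in (p : {pred R}).
pose C : {pred R} := fun f => boolp.asbool (S f).
have CP f : reflect (S f) (f \in C) by apply: boolp.asboolP.
have Cclosed : idealr_closed C.
  split.
  - by apply/CP; split=> [|p _]; rewrite ?mcoeff0 ?rpred0.
  - by apply/CP => -[/eqP]; rewrite mcoeff1 eqxx oner_eq0.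
  - move=> a u v /CP[u0 hu] /CP[v0 hv]; apply/CP; split.
      by rewrite mcoeffD rmorphM /= u0 v0 mulr0 addr0.
    by move=> p Zp; rewrite rpredD ?idealMl ?hu ?hv.
have Chomog f k : f \in C -> pihomog (@mdeg _) k f \in C.
  move=> /CP[f0 hf]; apply/CP; split; last by move=> p Zp; rewrite ideal_homog ?hf.
  rewrite pihomogE raddf_sum big1 //= => m _; rewrite mcoeffZ mcoeffX.
  by case: eqP => [->|]; rewrite ?f0 ?mul0r ?mulr0.
by exists (ClosedSubscheme Cclosed Chomog) => f; split=> /CP.
Qed.

Lemma ideal_mcoeff0 X (f : R) : f \in (X : {pred R}) -> f@_0%MM = 0.
Proof.
move=> /(ideal_homog 0) h; apply: (@idealC _ X).
suff -> : (f@_0%MM)%:MP = pihomog (@mdeg _) 0 f by [].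
rewrite [RHS](msize1_polyC (pihomog_msize 0 f)); congr (_%:MP).
apply/esym; rewrite pihomogE raddf_sum /= (eq_bigl (pred1 0%MM)); last first.
  by move=> m; rewrite /= mdeg_eq0.
have [f0|f0] := boolP (0%MM \in msupp f).
  rewrite -big_filter filter_pred1_uniq ?msupp_uniq // big_seq1.
  by rewrite mcoeffZ mcoeffX eqxx mulr1.
rewrite (memN_msupp_eq0 f0) big1_seq // => m /andP[/eqP -> h0].
by rewrite h0 in f0.
Qed.

(** The vanishing ideal of Z is its generic point. If it contains uv, the closed sets defined by u
    and by v cover Z, and irreducibility puts Z inside one of them. *)
Lemma irreducible_prime (Z : pset n) : irreducible_closed Z ->
  exists P : proj_point n, forall p, Z p <-> Defs.support P p.
Proof.
move=> [[J hJ] [p0 Zp0] irr].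
have [V hV] := vanishing_subscheme Z.
have Vp0 f : f \in (V : {pred R}) -> f \in (p0 : {pred R}) by move=> /hV[_]; apply.
have Vprime : homog_prime V.
  move=> u v /hV[uv0 uv]; apply/negPn/negP; rewrite negb_or => /andP[uV vV].
  (* As w may be inhomogeneous, the set is cut out by its own vanishing ideal. When w has a nonzero
     constant coefficient no point contains it, and that ideal contains all the variables. *)
  have cl w : zariski_closed (fun p : proj_point n => w \in (p : {pred R})).
    have [W hW] := vanishing_subscheme (fun p : proj_point n =>
      w \in (p : {pred R})).
    exists W => p; split=> [wp f /hW[_] //|Wp]; first exact.
    have [w0|/eqP w0] := boolP (w@_0%MM == 0); first by apply/Wp/hW; split=> //;
      apply/eqP.
    have [[q wq]|nq] := boolp.EM (exists q : proj_point n, w \in (q : {pred R})).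
      by case: w0; apply: (@ideal_mcoeff0 q).
    have [i hi] := point_relevant p; case/negP: hi.
    apply/Wp/hW; split; first by rewrite mcoeffX mnm1_eq0.
    by move=> q wq; case: nq; exists q.
  have nz w : w \notin (V : {pred R}) -> ~ psubset Z (fun p : proj_point n =>
    w \in (p : {pred R})).
    move=> /negP wV h; apply: wV; apply/hV; split=> //.
    by apply: (@ideal_mcoeff0 p0); apply: h.
  have [|hu|hv] := irr _ _ (cl u) (cl v).
  - by move=> p Zp; apply/orP; apply: (@point_prime n p); apply: uv.
  - exact: nz hu.
  - exact: nz hv.
have Vrel : exists i : 'I_n.+1, 'X_i \notin (V : {pred R}).
  have [i hi] := point_relevant p0; exists i; apply: contra hi; exact: Vp0.
exists (ProjPoint Vprime Vrel) => p; split=> [Zp f /hV[_] h|Vp]; first exact: h.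
apply/hJ => f fJ; apply: Vp; apply/hV; split; first exact: ideal_mcoeff0 fJ.
by move=> q /hJ; apply.
Qed.
End Primes.

Section KrullDimension.
Variable n : nat.
Implicit Types X Y : closed_subscheme n.
Implicit Types P Q : proj_point n.
Local Notation R := {mpoly rat[n.+1]}.

Lemma point_homog_prime P : homog_prime P.
Proof. exact: (@point_prime n P). Qed.

(** A form of Krull's principal ideal theorem for the section by l_0. Adding l_0 to parameters of
    the section gives parameters of X, so at most one is lost; a prime over the section with the
    same number of parameters is strictly larger than X, so at least one is lost. *)
Lemma hypersurface_prime X r (l : 'I_r.+2 -> R) : homog_prime X ->
  normalization X l ->
  exists Y (l' : 'I_r.+1 -> R), [/\ homog_prime Y, normalization Y l',
    {subset X <= (Y : {pred R})} & exists2 f : R,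
      f \in (Y : {pred R}) & f \notin (X : {pred R})].
Proof.
move=> pX nX; have [hl fin ind] := nX; pose l0 := l ord0.
have l0X : l0 \notin (X : {pred R}).
  apply/negP => h; have := ind 'X_ord0; rewrite evX =>
    /(_ h) /(congr1 (mcoeff U_(ord0))).
  by rewrite mcoeff0 mcoeffX eqxx => /eqP; rewrite oner_eq0.
have [Y0 hY0] := plus_subscheme X (fun _ : 'I_1 => hl ord0).
have l0Y0 : l0 \in (Y0 : {pred R}).
  by apply/hY0; exists (fun=> 1); rewrite big_ord1 mulr1 subrr rpred0.
have XY0 : {subset X <= (Y0 : {pred R})}.
  by move=> f fX; apply/hY0; exists (fun=> 0); rewrite big_ord1 mulr0 subr0.
have [s [l1 nY0]] := normalization_exists Y0.
have [hl1 fin1 ind1] := nY0.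
have par : parameters X s.+1.
  exists (fun i => if unlift ord0 i is Some j then l1 j else l0).
    by move=> i; case: unlift => [j|] //; exact: hl.
  have [N hN] := fin1; exists N => m /hN[h /hY0[h0 hX]].
  exists (fun i => if unlift ord0 i is Some j then h j else h0 ord0).
  rewrite big_ord_recl unlift_none opprD addrA.
  rewrite (eq_bigr (fun j => l1 j * h j)); last by move=> j _; rewrite liftK.
  by rewrite -addrA [- _ - _]addrC addrA; rewrite big_ord1 in hX.
have [Q [pQ Y0Q indQ]] := prime_over_indep hl1 ind1.
have nQ : normalization Q l1 by split=> //; apply: finite_overS fin1.
have XQ : {subset X <= (Q : {pred R})} by move=> f /XY0 /Y0Q.
have lt := prime_dim_lt pX XQ (Y0Q _ l0Y0) l0X nX nQ.
have le := alg_indep_le ind par.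
have e : s = r.+1 by apply/eqP; rewrite eqn_leq -ltnS lt -ltnS le.
by subst s; exists Q, l1; split=> //; exists l0; rewrite ?Y0Q.
Qed.

Lemma has_chain_dim P r (l : 'I_r.+1 -> R) : normalization P l ->
  has_chain (Defs.support P) r.
Proof.
elim: r P l => [|r IH] P l nP.
  exists (fun=> Defs.support P); split=> // i _.
  by split; [apply: support_irreducible | move].
have [Y [l' [pY nY XY [f fY fX]]]] := hypersurface_prime (@point_homog_prime P) nP.
pose Q := ProjPoint pY (relevant_of_dim nY).
have [c [hc hlt]] := IH Q l' nY.
have QP : psubset (Defs.support Q) (Defs.support P) by apply/support_sub.
exists (fun i => if (i <= r)%N then c i else Defs.support P); split=> i hi.
  case: ifP => [le|_].
    by have [h1 h2] := hc i le; split=> // p /h2/QP.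
  by split; [apply: support_irreducible | move].
rewrite (hi : (i <= r)%N).
have [lt|le] := ltnP i r; first exact: hlt.
have e : i = r by apply/eqP; rewrite eqn_leq le -ltnS hi.
have [_ cQ] := hc i hi; split; first by move=> p /cQ/QP.
move=> /(_ P (fun _ => id))/cQ h; move/negP: fX; apply; exact: (h f fY).
Qed.

(** Each strict inclusion adds a parameter by [prime_dim_lt], and the smallest member of the chain
    already has one because its generic point is relevant. *)
Lemma has_chain_le P r (l : 'I_r -> R) k : normalization P l ->
  has_chain (Defs.support P) k -> (k < r)%N.
Proof.
move=> nP [c [hc hlt]].
have dimc i : (i <= k)%N -> exists Q s (l' : 'I_s -> R),
    [/\ forall p, c i p <-> Defs.support Q p, normalization Q l' & (i < s)%N].
  elim: i => [|i IH] hi.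
    have [/irreducible_prime[Q hQ] _] := hc 0%N hi.
    have [s [l' nQ]] := normalization_exists Q.
    exists Q, s, l'; split=> //; have [j hj] := point_relevant Q.
    exact: dim_of_relevant (@point_homog_prime Q) nQ hj.
  have [Q [s [l' [hQ nQ lt]]]] := IH (ltnW hi).
  have [/irreducible_prime[Q' hQ'] _] := hc _ hi.
  have [s' [l'' nQ']] := normalization_exists Q'.
  exists Q', s', l''; split=> //.
  have [le nle] := hlt i hi.
  have sub : {subset Q' <= (Q : {pred R})}.
    by apply/support_sub => p /hQ/le/hQ'.
  have [f fQ fQ'] : exists2 f : R, f \in (Q : {pred R}) & f \notin (Q' : {pred R}).
    apply: boolp.contrapT => h; apply: nle => p /hQ' Q'p; apply/hQ => f fQ;
      apply: Q'p.
    by apply/negPn/negP => fQ'; apply: h; exists f.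
  exact: leq_ltn_trans lt (prime_dim_lt (@point_homog_prime Q') sub fQ fQ' nQ' nQ).
have [Q [s [l' [hQ [_ _ indQ] lt]]]] := dimc k (leqnn k).
apply: leq_trans lt (alg_indep_le indQ (parametersS _ (normalization_par nP))).
have [_ cP] := hc k (leqnn k).
by apply/support_sub => p /hQ/cP.
Qed.

Lemma krull_dim_prime P r (l : 'I_r.+1 -> R) : normalization P l ->
  krull_dim (Defs.support P) r.
Proof.
by move=> nP; split; [apply: has_chain_dim nP | move=> k /(has_chain_le nP)].
Qed.

Lemma krull_dim_uniq (Z : pset n) d e : krull_dim Z d -> krull_dim Z e -> d = e.
Proof.
move=> [cd hd] [ce he]; apply/eqP; rewrite eqn_leq.
by rewrite he //= hd.
Qed.

Lemma has_chainS (Y Z : pset n) k : psubset Y Z -> has_chain Y k -> has_chain Z k.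
Proof.
move=> YZ [c [hc hlt]]; exists c; split=> // i /hc[h1 h2].
by split=> // p /h2/YZ.
Qed.

(* A prime of largest dimension between X and P is minimal over X. *)
Lemma minimal_prime X P : {subset X <= (P : {pred R})} ->
  exists Q, [/\ {subset X <= (Q : {pred R})}, {subset Q <= (P : {pred R})} &
    irreducible_component X (Defs.support Q)].
Proof.
move=> XP.
pose good r := exists Q (l : 'I_r -> R), [/\ {subset X <= (Q : {pred R})},
  {subset Q <= (P : {pred R})} & normalization Q l].
have ex : exists r, boolp.asbool (good r).
  have [r [l nP]] := normalization_exists P.
  by exists r; apply/boolp.asboolP; exists P, l; split.
have bnd r : boolp.asbool (good r) -> (r <= n.+1)%N.
  move=> /boolp.asboolP[Q [l [_ _ [_ _ ind]]]].
  exact: alg_indep_le ind (parameters_vars Q).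
have [r /boolp.asboolP[Q [l [XQ QP nQ]]] rmax] := ex_maxnP ex bnd.
exists Q; split=> //; split.
- exact: support_irreducible.
- by move=> p Qp f /XQ/Qp.
- move=> Z' /irreducible_prime[Q' hQ'] Z'X QZ' p /hQ' Q'p f fQ; apply: Q'p.
  apply/negPn/negP => fQ'.
  have Q'Q : {subset Q' <= (Q : {pred R})} by apply/support_sub => q /QZ'/hQ'.
  have [r' [l' nQ']] := normalization_exists Q'.
  have := prime_dim_lt (@point_homog_prime Q') Q'Q fQ fQ' nQ' nQ.
  rewrite ltnNge rmax //; apply/boolp.asboolP; exists Q', l'; split=> //.
    by apply: Z'X; apply/hQ'.
  by move=> g /Q'Q/QP.
Qed.

(** Some prime over X keeps l independent, and a minimal prime below it is a component of dimension
    r. Purity gives Q the same dimension, so the r + 1 forms l, over which the ring of Q is finite,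
    cannot be dependent. *)
Lemma pure_dim_alg_indep X r (l : 'I_r.+1 -> R) Q :
  pure_dimensional X -> normalization X l ->
  {subset X <= (Q : {pred R})} -> irreducible_component X (Defs.support Q) ->
    alg_indep Q l.
Proof.
move=> pure nX XQ compQ; have [hl fin ind] := nX.
have [P1 [pP1 XP1 indP1]] := prime_over_indep hl ind.
have nP1 : normalization P1 l by split=> //; apply: finite_overS fin.
have [P0 [XP0 P0P1 compP0]] :=
  @minimal_prime X (ProjPoint pP1 (relevant_of_dim nP1)) XP1.
have nP0 : normalization P0 l.
  by split=> //; [apply: finite_overS fin | apply: alg_indepS indP1].
have [s [l' nQ]] := normalization_exists Q.
have [i hi] := point_relevant Q.
have := dim_of_relevant (@point_homog_prime Q) nQ hi.
case: s l' nQ => // s l' nQ _.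
have e : r = s.
  exact: krull_dim_uniq (pure _ _ compP0 compQ _ (krull_dim_prime nP0))
    (krull_dim_prime nQ).
subst s; exact: alg_indep_of_dim hl (finite_overS XQ fin) nQ.
Qed.

Lemma dimension_ge X r (l : 'I_r.+1 -> R) d :
  normalization X l -> dimension X d -> (r <= d)%N.
Proof.
move=> [hl fin ind] [_ maxd].
have [P1 [pP1 XP1 indP1]] := prime_over_indep hl ind.
have nP1 : normalization P1 l by split=> //; apply: finite_overS fin.
apply: maxd; apply: has_chainS (@has_chain_dim (ProjPoint pP1 (relevant_of_dim
  nP1)) _ _ nP1).
by move=> p P1p f /XP1/P1p.
Qed.

End KrullDimension.

(** * Generic rank and the Hilbert polynomial *)

Lemma lead_coef_ge0 (p : {poly rat}) (m0 : nat) :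
  (forall m : nat, (m0 <= m)%N -> 0 <= p.[m%:R]) -> 0 <= lead_coef p.
Proof.
move=> hp; rewrite leNgt; apply/negP => lt0.
have [|x hx] := @poly_pinfty_gt_lc _ (- p); first by rewrite lead_coefN oppr_gt0.
have [k hk] : exists k : nat, x <= k%:R.
  exists (Num.bound `|x|); apply: le_trans (ler_norm x) _.
  by apply/ltW/archi_boundP/normr_ge0.
have := hx (maxn k m0)%:R; rewrite hornerN lead_coefN lerN2.
move=> /(_ (le_trans hk _)); rewrite ler_nat leq_maxl => /(_ isT) h.
by have := le_trans (hp _ (leq_maxr k m0)) h; rewrite leNgt lt0.
Qed.

(** Both differences, [p - lo] and [up - p], are eventually nonnegative, hence so are their leading
    coefficients; a wrong size of p would give one of them the wrong sign. *)
Lemma lead_coef_growth (p : {poly rat}) (c C : rat) (e q0 : nat) : 0 < c ->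
  0 <= C ->
  (forall q : nat, (q0 <= q)%N ->
    c * q%:R ^+ e <= p.[q%:R] <= C * (q%:R + 1) ^+ e) ->
  size p = e.+1 /\ c <= lead_coef p.
Proof.
move=> c0 C0 hp.
pose lo : {poly rat} := c *: 'X^e; pose up : {poly rat} := C *: ('X + 1) ^+ e.
have plo : 0 <= lead_coef (p - lo).
  apply: (@lead_coef_ge0 _ q0) => m /hp/andP[h _].
  by rewrite hornerD hornerN hornerZ hornerXn subr_ge0.
have pup : 0 <= lead_coef (up - p).
  apply: (@lead_coef_ge0 _ q0) => m /hp/andP[_ h].
  by rewrite hornerD hornerN hornerZ horner_exp !hornerE subr_ge0.
have p0 : 0 <= lead_coef p.
  apply: (@lead_coef_ge0 _ q0) => m /hp/andP[h _]; apply: le_trans h.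
  by rewrite mulr_ge0 ?exprn_ge0 ?ler0n // ltW.
have slo : size lo = e.+1 by rewrite size_scale ?size_polyXn // gt_eqF.
have sup : (size up <= e.+1)%N.
  apply: leq_trans (size_scale_leq _ _) _.
  by apply: leq_trans (size_poly_exp_leq _ _) _; rewrite -polyC1 size_XaddC mul1n.
have sp : (size p <= e.+1)%N.
  rewrite leqNgt; apply/negP => lt.
  have : lead_coef (up - p) = - lead_coef p.
    rewrite -lead_coefN lead_coefDr // size_polyN.
    exact: leq_ltn_trans sup lt.
  move=> eq; move: pup; rewrite eq oppr_ge0 => pn.
  have /eqP : lead_coef p = 0 by apply/eqP; rewrite eq_le pn p0.
  by rewrite lead_coef_eq0 => /eqP pz; rewrite pz size_poly0 in lt.
have sp' : size p = e.+1.
  apply/eqP; rewrite eqn_leq sp ltnNge; apply/negP => lt.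
  move: plo; rewrite lead_coefDr ?size_polyN ?slo ?ltnS // lead_coefN.
  by rewrite lead_coefZ lead_coefXn mulr1 oppr_ge0 leNgt c0.
split=> //; rewrite leNgt; apply/negP => lt.
have ce : (p - lo)`_e = lead_coef p - c.
  by rewrite coefB coefZ coefXn eqxx mulr1 lead_coefE sp'.
have ssz : size (p - lo) = e.+1.
  apply/eqP; rewrite eqn_leq; apply/andP; split.
    by apply: leq_trans (size_polyD _ _) _; rewrite size_polyN sp' slo maxnn.
  rewrite ltnNge; apply/negP => /(nth_default 0); rewrite ce => /eqP.
  by rewrite subr_eq0 => /eqP h; rewrite h ltxx in lt.
by move: plo; rewrite lead_coefE ssz /= ce subr_ge0 leNgt lt.
Qed.

Section Basis.
Variable n : nat.
Implicit Types X : closed_subscheme n.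
Local Notation R := {mpoly rat[n.+1]}.

(* A basis, after inverting one element g, of the homogeneous coordinate ring
   over its Noether normalization. *)
Definition generic_basis X D (l : 'I_D -> R) r (u : 'I_r -> 'X_{1..n.+1})
    (g : {mpoly rat[D]}) (c0 : nat) :=
  [/\ g != 0,
    forall p, lin_comb (ev l) (fun j => 'X_[u j]) p \in (X : {pred R}) ->
      forall j, p j = 0
  & forall e (f : R), (msize f <= e.+1)%N -> exists2 a,
      forall j, (msize (a j) <= e + c0)%N &
      ev l g * f - lin_comb (ev l) (fun j => 'X_[u j]) a \in (X : {pred R})].

(** The basis is a maximal independent subset U of the monomials that generate over T. By maximality
    each generator b has a nonzero multiple, by [(ga b).1], in the span of U. *)
Lemma generic_basis_exists X D (l : 'I_D -> R) : (forall i, l i \is 1.-homog) ->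
  finite_over X l -> exists r u g c0, @generic_basis X D l r u g c0.
Proof.
move=> hl /(filtered_reduction hl)[N hN].
pose B := 'X_{1..n.+1 < N}.
pose lc (p : B -> {mpoly rat[D]}) := lin_comb (ev l) (fun b : B => 'X_[b] : R) p.
pose indU (U : {set B}) := forall p : B -> {mpoly rat[D]}, (forall b,
  b \notin U -> p b = 0) ->
  lc p \in (X : {pred R}) -> forall b, p b = 0.
have [U /maxsetP[/boolp.asboolP indepU maxU]] : {U | maxset (fun U =>
  boolp.asbool (indU U)) U}.
  apply: ex_maxset; exists set0; apply/boolp.asboolP => p h _ b.
  by apply: h; rewrite inE.
have rel (b : B) : exists ga : {mpoly rat[D]} * (B -> {mpoly rat[D]}),
    [/\ ga.1 != 0, forall c, c \notin U -> ga.2 c = 0 &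
      ev l ga.1 * 'X_[b] - lc ga.2 \in (X : {pred R})].
  have delta (p : {mpoly rat[D]}) : lc (fun c =>
    if c == b then p else 0) = ev l p * 'X_[b].
    rewrite /lc /lin_comb (bigD1 b) //= eqxx big1 ?addr0 // => c /negbTE ->.
    by rewrite rmorph0 mul0r.
  have [bU|bU] := boolP (b \in U).
    exists (1, fun c => if c == b then 1 else 0); split.
    - exact: oner_neq0.
    - by move=> c /=; have [->|//] := eqVneq c b; rewrite bU.
    - by rewrite delta subrr rpred0.
  have [p [hp pX pb]] : exists p : B -> {mpoly rat[D]},
      [/\ forall c, c \notin b |: U -> p c = 0, lc p \in (X : {pred R}) & p b != 0].
    apply: boolp.contrapT => no.
    have /maxU : boolp.asbool (indU (b |: U)).
      apply/boolp.asboolP => p hp pX; apply: indepU => // c cU.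
      have [->|cb] := eqVneq c b; last by apply: hp; rewrite !inE negb_or cb.
      by apply/eqP/negPn/negP => pb; apply: no; exists p.
    move=> /(_ (subsetUr _ _)) /setP/(_ b); rewrite !inE eqxx /=.
    by rewrite (negbTE bU).
  exists (p b, fun c => if c == b then 0 else - p c); split=> //=.
    move=> c cU; have [//|cb] := eqVneq c b; rewrite hp ?oppr0 //.
    by rewrite !inE negb_or cb.
  apply: etrans pX; rewrite -delta; congr (in_mem _ _).
  apply/eqP; rewrite subr_eq -lin_combD; apply/eqP.
  apply: eq_bigr => c _; congr (ev l _ * _).
  by have [->|_] := eqVneq c b; rewrite ?addr0 ?subrr.
have /(@fin_all_exists _ (fun=> _))[ga hga] := rel.
pose g := \prod_b (ga b).1.
(* The cofactor of b in the common denominator g: the relation for b is multiplied by it. *)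
pose gc b := \prod_(c | c != b) (ga c).1.
exists #|U|, (fun j : 'I_#|U| => bmnm (enum_val j)), g.
(* This bounds the growth of coefficients when the generators are rewritten in the basis,
   independently of f. *)
pose M := \max_b \max_c msize (gc b * (ga b).2 c).
have restr (p : B -> {mpoly rat[D]}) : (forall b, b \notin U -> p b = 0) ->
    lc p = lin_comb (ev l) (fun j : 'I_#|U| =>
      'X_[(enum_val j : B)] : R) (fun j => p (enum_val j)).
  move=> h; rewrite /lc /lin_comb.
  rewrite -(big_enum_val (fun b => ev l (p b) * 'X_[b])) [LHS](bigID (mem U)) /=.
  rewrite [X in _ + X]big1 ?addr0 // => b bU.
  by rewrite h // rmorph0 mul0r.
exists M.+1; split.
- by apply/prodf_neq0 => b _; have [] := hga b.
- move=> p pX j.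
  pose p' b := \sum_(i | enum_val i == b) p i.
  have p'E i : p' (enum_val i) = p i.
    by rewrite /p' (eq_bigl (pred1 i)) ?big_pred1_eq // => k;
      rewrite /= (inj_eq enum_val_inj).
  have p'U b : b \notin U -> p' b = 0.
    move=> bU; rewrite /p' big_pred0 // => i; apply: contraNF bU => /eqP <-.
    exact: enum_valP.
  rewrite -p'E; apply: indepU => //; rewrite restr //.
  apply: etrans pX; congr (in_mem _ _); apply: eq_bigr => i _.
  by rewrite p'E.
- move=> e f /hN[p [sp pX]].
  exists (fun j => \sum_b p b * (gc b * (ga b).2 (enum_val j))).
    move=> j; apply: msize_sum_le => b _; rewrite addnS.
    apply: msizeM_leD => //; apply: leqW.
    by apply: leq_trans (leq_bigmax b); apply: (leq_bigmax (enum_val j)).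
  rewrite lin_comb_sum.
  rewrite (_ : _ - _ = ev l g * (f - lc p) +
     \sum_b ev l (p b) * ev l (gc b) * (ev l (ga b).1 * 'X_[b] - lc (ga b).2)).
    rewrite rpredD ?idealMl // rpred_sum // => b _; rewrite idealMl //.
    by have [] := hga b.
  rewrite mulrBr -addrA; congr (_ + _);
    rewrite /lc /lin_comb mulr_sumr -!sumrN -big_split.
  apply: eq_bigr => b _ /=.
  rewrite [\sum_(j < _) _](_ : _ = ev l (p b) * ev l (gc b) * lc (ga b).2).
    have -> : g = (ga b).1 * gc b by rewrite /g (bigD1 b).
    rewrite (rmorphM (ev l)) /lc /lin_comb; ring.
  rewrite restr; last by have [] := hga b.
  rewrite /lin_comb mulr_sumr; apply: eq_bigr => j _.
  by rewrite !(rmorphM (ev l)) !mulrA.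
Qed.
End Basis.

Section HilbertFunction.
Variable n : nat.
Implicit Types X : closed_subscheme n.
Local Notation R := {mpoly rat[n.+1]}.

Lemma hilbert_function_ge X m h (J : finType) (v : J -> R) :
  hilbert_function X m h -> (forall j, v j \is m.-homog) ->
  (forall lam : J -> rat, \sum_j lam j *: v j \in (X : {pred R}) -> forall j,
    lam j = 0) ->
  (#|J| <= h)%N.
Proof.
move=> [U [hU ->]] hv ind; rewrite leqNgt; apply/negP => lt.
pose w j : dhomog n.+1 rat m := DHomog (hv j).
rewrite -dimv_compl in lt; set V := (U^C)%VS in lt.
have dec j : exists c : dhomog n.+1 rat m, c \in V /\ w j - c \in U.
  have : w j \in (U + V)%VS by rewrite addv_complf memvf.
  case/memv_addP => a aU [b bV e]; exists b; split=> //.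
  by rewrite e addrK.
have /(@fin_all_exists _ (fun=> _))[c hc] := dec.
have [|lam [j lamj] hlam] := @fin_pigeonhole rat J 'I_(\dim V) (fun j i =>
  coord (vbasis V) i (c j)).
  by rewrite card_ord.
case/eqP: lamj; apply: ind.
have : \sum_j lam j *: w j \in U.
  rewrite (_ : \sum_j _ = \sum_j lam j *: (w j - c j)).
    by apply: memv_suml => i _; apply: memvZ; have [] := hc i.
  suff cz : \sum_j lam j *: c j = 0.
    rewrite -[LHS]subr0 -[X in _ - X = _]cz -sumrB.
    by apply: eq_bigr => i _; rewrite scalerBr.
  have sV : \sum_j lam j *: c j \in V.
    by apply: memv_suml => i _; apply: memvZ; have [] := hc i.
  rewrite (coord_vbasis sV) big1 // => i _; rewrite linear_sum.
  rewrite (_ : \sum_j _ = 0) ?scale0r //.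
  by apply: etrans (hlam i); apply: eq_bigr => k _; rewrite linearZ.
move=> /hU; apply: etrans; congr (in_mem _ _).
by rewrite (linear_sum (@mpoly_of_dhomog n.+1 rat m)).
Qed.

Lemma hilbert_function_le X m h (J : finType) (v : J -> R) :
  hilbert_function X m h -> (forall j, v j \is m.-homog) ->
  (forall f : R, f \is m.-homog -> exists lam : J -> rat,
    f - \sum_j lam j *: v j \in (X : {pred R})) ->
  (h <= #|J|)%N.
Proof.
move=> [U [hU ->]] hv sp; rewrite leq_subLR.
pose w j : dhomog n.+1 rat m := DHomog (hv j).
have le : (fullv <= U + <<[seq w j | j : J]>>)%VS.
  apply/subvP => f _; have [lam hlam] := sp _ (dhomog_is_dhomog f).
  rewrite -[f](subrK (\sum_j lam j *: w j)); apply: memv_add.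
    apply/hU; apply: etrans hlam; congr (in_mem _ _).
    rewrite (linearB (@mpoly_of_dhomog n.+1 rat m)).
    by rewrite (linear_sum (@mpoly_of_dhomog n.+1 rat m)).
  apply: memv_suml => j _; apply: memvZ; apply: memv_span.
  by apply/mapP; exists j; rewrite ?mem_enum.
apply: leq_trans (dimvS le) _; apply: leq_trans (dimv_add_leqif _ _) _.
rewrite leq_add2l; apply: leq_trans (dim_span _) _.
by rewrite size_map -cardE.
Qed.

(* The exponent of total degree e whose coordinates other than the 0-th are
   given by ga. *)
Definition mnm_homog D q e (ga : {ffun 'I_D -> 'I_q.+1}) : 'X_{1..D.+1} :=
  [multinom (if unlift ord0 i is Some k then ga k : nat else e - \sum_k ga k)%N |
    i < D.+1].

Lemma mdeg_mnm_homog D q e (ga : {ffun 'I_D -> 'I_q.+1}) :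
  (\sum_k ga k <= e)%N -> mdeg (mnm_homog e ga) = e.
Proof.
move=> le; rewrite mdegE big_ord_recl mnmE unlift_none.
rewrite [X in (_ + X)%N](eq_bigr (fun k => ga k : nat)); first by rewrite subnK.
by move=> k _; rewrite mnmE liftK.
Qed.

Lemma mnm_homog_inj D q e : injective (@mnm_homog D q e).
Proof.
move=> a b eq; apply/ffunP => k; apply: val_inj.
by have := congr1 (fun x : 'X_{1..D.+1} => x (lift ord0 k)) eq; rewrite !mnmE liftK.
Qed.

Lemma mnm_homog_surj D q (al : 'X_{1..D.+1}) : (mdeg al <= q)%N ->
  exists2 ga : {ffun 'I_D -> 'I_q.+1},
    al = mnm_homog (mdeg al) ga & (\sum_k ga k <= mdeg al)%N.
Proof.
move=> le; have lek k : (al (lift ord0 k) <= q)%N.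
  by apply: leq_trans le; rewrite mdegE (bigD1 (lift ord0 k)) //= leq_addr.
pose ga : {ffun 'I_D -> 'I_q.+1} := [ffun k => inord (al (lift ord0 k))].
have gaE k : ga k = al (lift ord0 k) :> nat by rewrite ffunE inordK // ltnS.
have sumE : (al ord0 + \sum_k ga k)%N = mdeg al.
  by rewrite mdegE big_ord_recl; congr (_ + _)%N; apply: eq_bigr => k _;
    rewrite gaE.
exists ga; last by rewrite -sumE leq_addl.
apply/mnmP => i; rewrite mnmE; case: (unliftP ord0 i) => [k ->|->].
  by rewrite gaE.
by rewrite -sumE addnK.
Qed.

(** In each rank, D exponents range freely over [0, q] and the 0-th one completes the degree. The
    factor [D.+1], nonzero even for D = 0, leaves room for this and makes the degree grow with q. *)
Lemma hilbert_growth_ge X D (l : 'I_D.+1 -> R) r u g c0 :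
  (forall i, l i \is 1.-homog) -> @generic_basis n X _ l r u g c0 ->
  exists N, forall q h, hilbert_function X (N + D.+1 * q) h ->
    (r * q.+1 ^ D <= h)%N.
Proof.
move=> hl [_ ind _]; pose N := \max_j mdeg (u j); exists N => q h hh.
pose m := (N + D.+1 * q)%N.
have uN j : (mdeg (u j) <= N)%N by apply: leq_bigmax.
pose J := ('I_r * {ffun 'I_D -> 'I_q.+1})%type.
pose mon j (ga : {ffun 'I_D -> 'I_q.+1}) := mnm_homog (m - mdeg (u j)) ga.
have dmon j ga : mdeg (mon j ga) = (m - mdeg (u j))%N.
  apply: mdeg_mnm_homog; apply: (@leq_trans (D * q)).
    rewrite -[D in (D * q)%N]card_ord -sum_nat_const; apply: leq_sum => k _.
    by rewrite -ltnS.
  have := uN j; rewrite /m mulSn; lia.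
pose v (j : J) : R := ev l 'X_[mon j.1 j.2] * 'X_[u j.1].
have := @hilbert_function_ge X m h J v hh; rewrite card_prod card_ffun !card_ord;
  apply.
  move=> [j ga]; rewrite /v /=.
  rewrite -(_ : ((m - mdeg (u j)) + mdeg (u j))%N = m); last first.
    by rewrite subnK // /m; apply: leq_trans (uN j) _; rewrite leq_addr.
  apply: dhomogM; last by rewrite dhomogX.
  by rewrite -[X in X.-homog]mul1n; apply: ev_homog => //; rewrite dhomogX /= dmon.
move=> lam hlam [j ga].
pose p i := \sum_ga lam (i, ga) *: ('X_[mon i ga] : {mpoly rat[D.+1]}).
have pj : p j = 0.
  apply: ind; apply: etrans hlam; congr (in_mem _ _).
  have -> : \sum_j lam j *: v j = \sum_i \sum_ga lam (i, ga) *: v (i, ga).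
    by rewrite pair_bigA; apply: eq_bigr => -[].
  rewrite /lin_comb; apply: eq_bigr => i _; rewrite (rmorph_sum (ev l)) mulr_suml.
  by apply: eq_bigr => be _; rewrite /= evZ -scalerAl.
move: pj => /(congr1 (mcoeff (mon j ga)));
  rewrite mcoeff0 raddf_sum /= (bigD1 ga) //=.
rewrite mcoeffZ mcoeffX eqxx mulr1 big1 ?addr0 // => be ne.
rewrite mcoeffZ mcoeffX; case: eqP => [/mnm_homog_inj e|_]; last by rewrite mulr0.
by rewrite e eqxx in ne.
Qed.

(** For each of the finitely many generators, a monomial of prescribed degree in the D + 1 forms is
    determined by D exponents, each at most m. *)
Lemma hilbert_growth_le X D (l : 'I_D.+1 -> R) : (forall i, l i \is 1.-homog) ->
  finite_over X l -> exists C, forall m h, hilbert_function X m h ->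
    (h <= C * m.+1 ^ D)%N.
Proof.
move=> hl /(graded_reduction hl)[N hN]; exists #|{: 'X_{1..n.+1 < N}}| => m h hh.
pose J := ('X_{1..n.+1 < N} * {ffun 'I_D -> 'I_m.+1})%type.
pose ok (j : J) := ((mdeg j.1 <= m) && (\sum_k j.2 k <= m - mdeg j.1))%N.
pose v (j : J) : R := if ok j then
  ev l 'X_[mnm_homog (m - mdeg j.1) j.2] * 'X_[j.1] else 0.
have := @hilbert_function_le X m h J v hh; rewrite card_prod card_ffun !card_ord;
  apply.
  move=> j; rewrite /v; case: ifP => [/andP[le les]|_]; last exact: dhomog0.
  rewrite -[m in m.-homog](subnK le); apply: dhomogM; last by rewrite dhomogX.
  by rewrite -[X in X.-homog]mul1n; apply: ev_homog => //;
    rewrite dhomogX /= mdeg_mnm_homog.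
move=> f /hN[p [hp fX]].
pose Sp (s : R) := exists lam : J -> rat, s = \sum_j lam j *: v j.
suff [lam e] : Sp (lin_comb (ev l) (fun b : 'X_{1..n.+1 < N} => 'X_[b]) p).
  by exists lam; rewrite -e.
have Sp0 : Sp 0 by exists (fun=> 0); rewrite big1 // => j _; rewrite scale0r.
have SpD s t : Sp s -> Sp t -> Sp (s + t).
  move=> [a ->] [b ->]; exists (fun j => a j + b j); rewrite -big_split.
  by apply: eq_bigr => j _; rewrite scalerDl.
rewrite /lin_comb; elim/big_ind: _ => // b _.
have [hb0 hb] := hp b; have [le|/hb ->] := leqP (mdeg b) m;
  last by rewrite rmorph0 mul0r.
rewrite [p b]mpolyE (rmorph_sum (ev l)) mulr_suml big_seq.
elim/big_ind: _ => // al alp.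
have dal : mdeg al = (m - mdeg b)%N by move/dhomogP: hb0; apply.
have [|ga ega sga] := @mnm_homog_surj D m al; first by rewrite dal leq_subr.
exists (fun j => if j == (b, ga) then (p b)@_al else 0).
rewrite (bigD1 (b, ga)) //= eqxx big1 ?addr0; last by move=> j /negbTE ->;
  rewrite scale0r.
by rewrite /v /ok /= le -dal sga -ega evZ -scalerAl.
Qed.

(** The lower bound concerns the degrees N + (D + 1) q only, so P is composed with this linear
    polynomial Q. The growth bounds force P o Q to have degree D and leading coefficient at least r;
    that coefficient is the one of P times (D + 1)^D. *)
Lemma hilbert_polynomial_bound X D (l : 'I_D.+1 -> R) r u g c0 P :
  (forall i, l i \is 1.-homog) -> finite_over X l ->
    @generic_basis n X _ l r u g c0 ->
  hilbert_polynomial X P -> (r%:R <= lead_coef P * D.+1%:R ^+ D).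
Proof.
move=> hl fin gb [m0 hP].
have [N hge] := hilbert_growth_ge hl gb.
have [C hle] := hilbert_growth_le hl fin.
pose Q : {poly rat} := D.+1%:R *: 'X + N%:R%:P.
have Q1 : size (D.+1%:R *: 'X : {poly rat}) = 2%N.
  by rewrite size_scale ?size_polyX // pnatr_eq0.
have sQ : size Q = 2%N.
  by rewrite size_polyDl ?Q1 // (leq_ltn_trans (size_polyC_leq1 _)).
have lQ : lead_coef Q = D.+1%:R.
  rewrite lead_coefDl ?lead_coefZ ?lead_coefX ?mulr1 // Q1.
  by rewrite (leq_ltn_trans (size_polyC_leq1 _)).
have QE (q : nat) : Q.[q%:R] = (N + D.+1 * q)%:R.
  by rewrite /Q hornerD hornerZ hornerX hornerC natrD natrM addrC.
have hF (q : nat) : (m0 <= q)%N -> exists h : nat,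
    [/\ (P \Po Q).[q%:R] = h%:R,
      (r * q.+1 ^ D <= h)%N & (h <= C * (N + D.+1 * q).+1 ^ D)%N].
  move=> le; have [|h hh e] := hP (N + D.+1 * q)%N; first by nia.
  by exists h; rewrite horner_comp QE e; split=> //; [apply: hge | apply: hle].
have [->|r0] := posnP r.
  rewrite mulr_ge0 ?exprn_ge0 ?ler0n //; apply: (@lead_coef_ge0 _ m0) =>
    m /hP[h _ ->].
  exact: ler0n.
have [||q hq|sF] := @lead_coef_growth (P \Po Q) r%:R (C * (N + D.+1).+1 ^ D)%:R D
  m0.
- by rewrite ltr0n.
- exact: ler0n.
- have [h [-> h1 h2]] := hF q hq;
  rewrite [q%:R + 1]natr1 -!natrX -!natrM !ler_nat; apply/andP; split.
    apply: leq_trans h1; rewrite leq_mul2l; apply/orP; right.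
    by case: (D) => // k; rewrite leq_exp2r.
  apply: leq_trans h2 _; rewrite -mulnA leq_mul2l -expnMn; apply/orP; right.
  case: (D) => // k; rewrite leq_exp2r //; nia.
rewrite lead_coef_comp ?sQ // lQ -(size_comp_poly2 P sQ) sF.
by [].
Qed.
End HilbertFunction.

(** * Counting the integral points of a box *)

Section Counting.
Variable n : nat.
Implicit Types X : closed_subscheme n.
Local Notation R := {mpoly rat[n.+1]}.

(** The ideal of the projective point through x, as the homogeneous core of the kernel of evaluation
    at x. *)
Lemma rational_point (x : 'I_n.+1 -> rat) (i : 'I_n.+1) : x i != 0 ->
  exists P : proj_point n, forall f : R, f \in (P : {pred R}) <->
    forall k, (pihomog (@mdeg _) k f).@[x] = 0.
Proof.
move=> xi; pose K : {pred R} := fun f => f.@[x] == 0.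
have KE f : (f \in K) = (f.@[x] == 0) by [].
have Kc : idealr_closed K.
  split; rewrite ?KE ?meval0 ?meval1 ?oner_eq0 // => a u v;
    rewrite !KE mevalD mevalM.
  by move=> /eqP -> /eqP ->; rewrite mulr0 addr0.
have Kp : prime_idealr_closed K by move=> u v; rewrite !KE mevalM mulf_eq0.
have [Q [Qp hQ]] := homog_core Kc Kp.
have Qrel : exists i : 'I_n.+1, 'X_i \notin (Q : {pred R}).
  exists i; apply/negP => /hQ/(_ 1%N);
    rewrite pihomog_dE ?dhomogX /= ?mdeg1 // KE mevalXU.
  by rewrite (negbTE xi).
exists (ProjPoint Qp Qrel) => f; split=> [/hQ h k|h]; first exact/eqP/h.
by apply/hQ => k; apply/eqP/h.
Qed.

Section Box.
Variable b : nat.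
Local Notation box := {ffun 'I_n.+1 -> 'I_(b + b).+1}.

Definition box_coord (t : box) : 'rV[int]_n.+1 := \row_i ((t i)%:Z - b%:Z).
Definition box_pt (t : box) (i : 'I_n.+1) : rat := (box_coord t ord0 i)%:~R.

(** The numerator of Lagrange interpolation on the box. Each of the n + 1 coordinates excludes 2b
    values, which gives the degree 2b(n + 1). *)
Definition separator (t : box) : R :=
  \prod_i \prod_(a : 'I_(b + b).+1 | a != t i) ('X_i - ((a%:Z - b%:Z)%:~R)%:MP).

Lemma separatorE t s : (separator t).@[box_pt s] != 0 <-> s = t.
Proof.
have E : (separator t).@[box_pt s] =
    \prod_i \prod_(a : 'I_(b + b).+1 | a != t i) ((s i)%:Z - a%:Z)%:~R.
  rewrite /separator rmorph_prod; apply: eq_bigr => i _.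
  rewrite rmorph_prod; apply: eq_bigr => a _ /=.
  rewrite mevalB mevalXU mevalC /box_pt /box_coord mxE -rmorphB; congr (_%:~R); lia.
rewrite E; split=> [/prodf_neq0 h|->].
  apply/ffunP => i; apply/eqP/negPn/negP => ne.
  have /prodf_neq0/(_ (s i) ne) := h i isT.
  by rewrite subrr eqxx.
apply/prodf_neq0 => i _; apply/prodf_neq0 => a ne.
by rewrite intr_eq0 subr_eq0 eq_sym; apply: contraNneq ne => -[/val_inj ->].
Qed.

Lemma msize_separator t : (msize (separator t) <= (n.+1 * (b + b)).+1)%N.
Proof.
rewrite /separator -[n.+1 in leqRHS]card_ord -sum_nat_const.
elim/big_rec2: _ => [|i p q _ IH]; first by rewrite msize1.
apply: msizeM_leD IH.
have e : (\sum_(a : 'I_(b + b).+1 | a != t i) 1 = b + b)%N.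
  by rewrite sum1_card cardC1 card_ord.
rewrite -[X in (_ <= X.+1)%N]e.
elim/big_rec2: _ => [|a p' q' _ IH]; first by rewrite msize1.
apply: msizeM_leD IH; apply: leq_trans (msizeD_le _ _) _.
by rewrite msizeN msizeX mdeg1 msizeC geq_max; case: (_ != _).
Qed.

Lemma box_pt0 t : (\big[gcdn/0%N]_(i < n.+1) `|box_coord t ord0 i|%N = 1)%N ->
  exists i, box_pt t i != 0.
Proof.
move=> g1; apply: boolp.contrapT => h; suff : 0%N = 1%N by [].
rewrite -g1; apply/esym; elim/big_ind: _ => [//|x y -> -> //|i _].
apply/eqP; rewrite absz_eq0 -(intr_eq0 rat); apply/negPn/negP => hi.
by apply: h; exists i.
Qed.

Lemma box_count X D (l : 'I_D.+1 -> R) r u g c0 (E : {set box}) :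
  pure_dimensional X -> normalization X l -> @generic_basis n X _ l r u g c0 ->
  (forall t, t \in E -> exists i, box_pt t i != 0) ->
  (forall t, t \in E -> forall f : R, f \in (X : {pred R}) -> f.@[box_pt t] = 0) ->
  (#|E| <= r * (n.+1 * (b + b)).+1 ^ D.+1)%N.
Proof.
move=> pure nX [g0 ind red] E0 EX; rewrite leqNgt; apply/negP => lt.
have [A [pi piX]] := quotient_morphism X.
pose tau : {rmorphism {mpoly rat[D.+1]} -> A} := pi \o ev l.
pose ua (j : 'I_r) := pi 'X_[u j].
have lcE p : lin_comb tau ua p = pi (lin_comb (ev l) (fun j => 'X_[u j]) p).
  by rewrite /lin_comb rmorph_sum; apply: eq_bigr => j _; rewrite rmorphM.
have redA e (f : R) : (msize f <= e.+1)%N -> exists2 a,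
    tau g * pi f = lin_comb tau ua a & forall j, (msize (a j) <= e + c0)%N.
  move=> /red[a sa]; rewrite piX rmorphB rmorphM subr_eq0 => /eqP e1.
  by exists a => //; rewrite lcE -e1.
pose f (i : 'I_#|E|) := separator (enum_val i).
pose m := (n.+1 * (b + b))%N.
pose F (lam : 'I_#|E| -> rat) : R := \sum_i lam i *: f i.
have FA lam : \sum_i tau (lam i)%:MP * pi (f i) = pi (F lam).
  rewrite /F rmorph_sum; apply: eq_bigr => i _.
  by rewrite /tau /= evC -rmorphM mul_mpolyC.
have sF lam : (msize (F lam) <= m.+1)%N.
  apply: msize_sum_le => i _; apply: leq_trans (msizeZ_le _ _) _.
  exact: msize_separator.
have [|||||lam [i0 lam0] [k hk]] :=
  @fat_point_kernel _ _ _ tau 'I_r 'I_#|E| ua g (fun i => pi (f i)) m c0 _ g0.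
- by move=> p; rewrite lcE => /eqP; rewrite -piX => /ind.
- move=> i j; have [|a ha _] :=
  redA (msize ('X_[u i] * 'X_[u j] : R)) ('X_[u i] * 'X_[u j]).
    exact: leqnSn.
  by exists a; rewrite -ha rmorphM.
- by move=> i; have [|a ha _] := redA m (f i); [exact: msize_separator | exists a].
- move=> lam k; have [|a ha sa] := redA (k * m)%N (F lam ^+ k);
  first exact: msizeX_le.
  by exists a => //; rewrite -ha FA rmorphXn.
- by rewrite !card_ord.
have gF : ev l g * F lam ^+ k \in (X : {pred R}).
  by rewrite piX rmorphM rmorphXn -FA; apply/eqP/hk.
have vanish t : t \in E -> (F lam).@[box_pt t] = 0.
  move=> tE; have [i /rational_point[P hP]] := E0 t tE.
  have XP : {subset X <= (P : {pred R})}.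
    by move=> h hX; apply/hP => j; apply: EX => //; apply: ideal_homog.
  (* Q is minimal over X so that purity applies: [ev l g] stays outside Q, so Q contains [F lam],
     and with it the ideal of the point does. *)
  have [Q [XQ QP compQ]] := minimal_prime XP.
  have indQ := pure_dim_alg_indep pure nX XQ compQ.
  have /hP h : F lam \in (P : {pred R}).
    apply: QP; apply: (@homog_primeX _ _ _ k (@point_homog_prime _ Q)).
    have /(@point_homog_prime _ Q)/orP[/indQ e|//] := XQ _ gF.
    by rewrite e eqxx in g0.
  rewrite (pihomog_partitionE (leqnn (msize (F lam)))) rmorph_sum big1 // => j _.
  exact: h.
(* At the vector numbered [i0] all other separators vanish, so the value is a nonzero multiple of
   [lam i0]. *)
have := vanish (enum_val i0) (enum_valP i0).
rewrite /F rmorph_sum (bigD1 i0) //= mevalZ big1 ?addr0.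
  move/eqP; rewrite mulf_eq0 (negbTE lam0) /=.
  by have /separatorE/negbTE -> : enum_val i0 = enum_val i0 by [].
move=> i ne; rewrite mevalZ; apply/eqP; rewrite mulf_eq0; apply/orP; right.
apply/negPn/negP => /separatorE/enum_val_inj e.
by rewrite e eqxx in ne.
Qed.

Lemma box_coord_surj (x : 'rV[int]_n.+1) : (height x <= b)%N -> exists t,
  box_coord t = x.
Proof.
move=> /bigmax_leqP hx; exists [ffun i => inord `|(x ord0 i + b%:Z)%R|%N].
apply/rowP => i; rewrite mxE ffunE; have := hx i isT => hi.
move: (x ord0 i) hi => y hi; by rewrite inordK; lia.
Qed.

Lemma height_box_coord t : (height (box_coord t) <= b)%N.
Proof.
apply/bigmax_leqP => i _; rewrite mxE; have := ltn_ord (t i); lia.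
Qed.
End Box.

Lemma parameters_no_point X (P : proj_point n) :
  {subset X <= (P : {pred R})} -> ~ parameters X 0.
Proof.
move=> XP /(parametersS XP) par.
have [r [l nP]] := normalization_exists P; have [i hi] := point_relevant P.
have := dim_of_relevant (@point_homog_prime _ P) nP hi.
by have [_ _ /alg_indep_le/(_ par)] := nP; rewrite leqn0 => /eqP ->.
Qed.

Lemma box_degree_count X delta d b (E : {set {ffun 'I_n.+1 -> 'I_(b + b).+1}}) :
  pure_dimensional X -> dimension X d -> degree X delta -> (0 < b)%N ->
  (forall t, t \in E -> exists i, box_pt t i != 0) ->
  (forall t, t \in E -> forall f : R, f \in (X : {pred R}) -> f.@[box_pt t] = 0) ->
  (#|E| <= n.+1 ^ n * (2 * n + 3) ^ n.+1 * delta * b ^ d.+1)%N.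
Proof.
move=> pure dimX [d' [P [dimX' hP hdeg]]] b0 E0 EX.
have [D [l nX]] := normalization_exists X.
case: D l nX => [|D] l nX.
  (* Without parameters X has no point at all. *)
  suff -> : E = set0 by rewrite cards0.
  apply/setP => t; rewrite inE; apply/negP => tE.
  have [i /rational_point[Q hQ]] := E0 t tE.
  apply: (@parameters_no_point X Q) (normalization_par nX).
  by move=> h hX; apply/hQ => j; apply: EX => //; apply: ideal_homog.
have [hl fin ind] := nX.
have [r [u [g [c0 gb]]]] := generic_basis_exists hl fin.
apply: leq_trans (box_count pure nX gb E0 EX) _.
have Dn : (D.+1 <= n.+1)%N := alg_indep_le ind (parameters_vars X).
have Dd : (D <= d)%N := dimension_ge nX dimX.
have rdelta : (r <= delta * D.+1 ^ D)%N.
  have h := hilbert_polynomial_bound hl fin gb hP.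
  rewrite -(ler_nat rat) natrM natrX; apply: le_trans h _.
  (* Since d'! >= 1 and the leading coefficient times d'! equals delta, that coefficient is
     nonnegative and at most delta. *)
  rewrite ler_wpM2r ?exprn_ge0 ?ler0n //.
  have f0 : (0 : rat) < (d'`!)%:R by rewrite ltr0n fact_gt0.
  rewrite -hdeg -[leLHS]mulr1 ler_wpM2l ?ler1n ?fact_gt0 //.
  by rewrite -(pmulr_lge0 _ f0) hdeg ler0n.
apply: (@leq_trans ((delta * n.+1 ^ n) * ((2 * n + 3) ^ n.+1 * b ^ d.+1)));
  last first.
  by rewrite -!mulnA mulnCA leq_mul2l mulnCA leqnn orbT.
apply: leq_mul.
  apply: leq_trans rdelta _; rewrite leq_mul2l; apply/orP; right.
  apply: leq_trans (_ : n.+1 ^ D <= _)%N; last by rewrite leq_pexp2l.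
  by case: (D) Dn => // k Dn; rewrite leq_exp2r.
(* As b >= 1, the 1 in 2b(n + 1) + 1 is absorbed into (2n + 3) b. *)
apply: (@leq_trans (((2 * n + 3) * b) ^ D.+1)).
  by rewrite leq_exp2r //; nia.
rewrite expnMn; apply: leq_mul; rewrite leq_pexp2l //; lia.
Qed.
End Counting.

(** * From integral vectors in a box to rational points of bounded height *)

Unset Implicit Arguments.

Theorem theorem3p3 (R : realType) (n : nat) (hn : (2 <= n)%N) :
  exists C : R, 0 <= C /\
    forall delta d : nat, (1 <= delta)%N -> (1 <= d)%N ->
    forall X : closed_subscheme n,
      pure_dimensional X -> dimension X d -> degree X delta ->
    forall B : R, 1 <= B ->
      exists s : seq (rat_point n),
        [/\ uniq s,
            forall xi : rat_point n, xi \in s <-> in_S X B xi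
          & (size s)%:R <= C * delta%:R * B ^+ d.+1].
Proof.
exists (n.+1 ^ n * (2 * n + 3) ^ n.+1)%:R; split; first exact: ler0n.
move=> delta d _ _ X pure dimX degX B B1.
have B0 : 0 <= B by apply: le_trans B1.
(* Heights are integers, so B may be replaced by its integer part. *)
pose b := Num.truncn B.
have Bb k : (k%:R <= B) = (k <= b)%N by rewrite -truncn_ge_nat.
have b0 : (0 < b)%N by rewrite -Bb.
pose good (t : {ffun 'I_n.+1 -> 'I_(b + b).+1}) :=
  (\big[gcdn/0%N]_(i < n.+1) `|box_coord t ord0 i|%N = 1)%N /\
  forall f : {mpoly rat[n.+1]}, f \in (X : {pred _}) -> f.@[box_pt t] = 0.
pose E := [set t | boolp.asbool (good t)].
have EP t : reflect (good t) (t \in E) by rewrite inE; apply: boolp.asboolP.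
pose line (t : {ffun 'I_n.+1 -> 'I_(b + b).+1}) : {vspace 'rV[rat]_n.+1} :=
  <[map_mx intr (box_coord t)]>%VS.
(* Duplicates do occur: opposite primitive vectors span the same line. *)
exists (undup (pmap insub [seq line t | t in E])); split.
- exact: undup_uniq.
- move=> xi; rewrite mem_undup mem_pmap_sub; split.
    case/imageP => t /EP[g1 van] e; exists (box_coord t); split=> //.
    by rewrite Bb height_box_coord.
  case=> x [[g1 e] van]; rewrite Bb => /box_coord_surj[t tx]; subst x.
  by apply/imageP; exists t => //; apply/EP.
have sE : (size (undup (pmap insub [seq line t | t in E] : seq (rat_point n))) <= #|E|)%N.
  apply: leq_trans (size_undup _) _; rewrite size_pmap_sub.
  by apply: leq_trans (count_size _ _) _; rewrite size_image.
have cE := @box_degree_count n X delta d b E pure dimX degX b0.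
apply: le_trans (_ : (n.+1 ^ n * (2 * n + 3) ^ n.+1 * delta * b ^ d.+1)%:R <= _).
  rewrite ler_nat; apply: leq_trans sE _; apply: cE => t /EP[g1 van] //.
  exact: box_pt0.
rewrite natrM (natrM _ (_ * _)%N) natrX; apply: ler_wpM2l; first by rewrite mulr_ge0.
by apply: lerXn2r; rewrite ?nnegrE ?ler0n ?Bb.
Qed.
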